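(* There exist absolute constants $c,C>0$ such that the following holds. Let $\alpha\in\left(\frac{1}{c\log n},\,1-\frac{C\log\log n}{\log n}\right)$. Suppose that $\sigma\in S_n$ has at most $c\alpha n^{\alpha}$ cycles. Then $$\left|\frac{\chi(\sigma)}{\chi(1)}\right|\le\chi(1)^{\alpha-1}$$ for all irreducible characters $\chi$ of $S_n$.
   Context: $S_n$ is the symmetric group on $n$ letters; irreducible characters are the complex irreducible characters. The number of cycles of a permutation counts all cycles in its disjoint cycle decomposition, including fixed points (cycles of length $1$). The logarithm is natural. *)

(* Defs.v *)
From mathcomp Require Import all_boot all_order all_algebra all_fingroup.
From mathcomp Require Import mxrepresentation.
From mathcomp Require Import complex.
From mathcomp Require Import reals.

Set Implicit Arguments.
Unset Strict Implicit.
Unset Printing Implicit Defensive.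

Import GRing.Theory Num.Theory.
Local Open Scope ring_scope.

(* The complex numbers are R[i] for a realType R, rather than the algC over   *)
(* which the library's 'CF(G) and irr G are built, so that character values   *)
(* can be compared with real powers. Irreducibility is that of the            *)
(* representation over R[i] (of positive degree), and chi 1 is its degree.    *)
Definition complex_irr_char (R : realType) (gT : finGroupType)
    (G : {group gT}) (chi : gT -> R[i]) : Prop :=
  exists d (rG : mx_representation R[i] G d),
    mx_irreducible rG /\ {in G, forall g, chi g = \tr (rG g)}.

(* porbits also contains the singleton orbits, i.e. the fixed points. *)
Definition num_cycles (n : nat) (s : 'S_n) : nat := #|porbits s|.

(* Main.v *)
Require Import Defs.
From mathcomp Require Import all_boot all_order all_algebra all_fingroup.
From mathcomp Require Import mxrepresentation separable cyclotomic.
From mathcomp Require Import complex.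
From mathcomp Require Import reals sequences exp.
From mathcomp Require Import ring lra zify.

(** Throughout, V is an irreducible representation of S_n of degree d with
    character chi, sigma has m cycles, and k-junta means: vector fixed by every
    permutation of the complement of some k-set A. [junta A] is the projection onto
    those vectors, and the level of V is the least k for which a nonzero one
    exists. The target is |chi(sigma)| <= d^alpha, and there are two regimes, split
    at the level K = n^alpha / (1 - alpha).

    High level. Restrict V to the group generated by N = n/2 disjoint
    transpositions; V is a sum of weight lines, a weight being the set of the
    transpositions acting by -1. If a weight of size between t and N - t occurs then
    by symmetry all sets of that size occur, so d >= 'C(N, t). Otherwise the small
    weights span an invariant subspace, so, up to tensoring V with the sign, every
    weight is small; a vector of maximal weight S is then fixed by all transpositions
    away from S, which bounds the level by 2(t - 1) ([low_level_or_degree]).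
    When d >= 'C(N, t) with t about K, the orthogonality relations suffice:
    |chi(sigma)|^2 <= |C(sigma)| <= n^m, and n^(m/2) <= 'C(N, t)^alpha.

    Low level. Let V have level k and let f be the rank of [junta A] for |A| = k.
    Schur's lemma makes the sum of all [junta A] scalar, so chi(sigma) is
    proportional to the sum over A of tr(sigma [junta A]). Minimality of k says that
    averaging a k-junta over the values of one of its coordinates gives 0; exchanging
    the coordinates which sigma moves out of A, one at a time, this yields
      |tr(sigma [junta A])| <= f / 'C(n - k, t),   t = #{a in A : sigma a notin A}
    ([norm_trace_junta]). Few sets A have small t, because such a set is made of t
    arcs of cycles of sigma and of some whole cycles ([card_exits_eq_le]). The
    outcome is |chi(sigma)| / d <= (32 max(m, k) / n)^k. On the other hand
    d <= 'C(n, k) f since the [junta A] span V, and d f <= n^k since V occurs f times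
    in the permutation module on the injections of a k-set; hence
    d^2 <= 'C(n, k) n^k ([degree_sqr_le]), and the two bounds combine. *)

Set Implicit Arguments.
Unset Strict Implicit.
Unset Printing Implicit Defensive.

Import Order.TTheory GRing.Theory Num.Theory.
Local Open Scope ring_scope.

(** * Diagonalization and traces *)

Section LinearAlgebra.
Variable F : numClosedFieldType.

Lemma diagonalizable_root d (X : 'M[F]_d.+1) rs :
  uniq rs -> horner_mx X (\prod_(z <- rs) ('X - z%:P)) = 0 -> diagonalizable X.
Proof.
move=> Urs Xrs; apply/diagonalizableP; exists rs => //.
exact: mxminpoly_min.
Qed.

Lemma idem_diagonalizable d (Q : 'M[F]_d) : Q *m Q = Q -> diagonalizable Q.
Proof.
case: d Q => [|d] Q QQ.
  by exists 1%:M; rewrite ?unitmx1 //; apply/diagonalizable_forPp => -[].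
apply: (@diagonalizable_root _ _ [:: 0; 1]); first by rewrite /= inE eq_sym oner_eq0.
rewrite !big_cons big_nil mulr1 rmorphM !rmorphB /= horner_mx_X !horner_mx_C.
by rewrite raddf0 subr0 mulrBr mulr1 [Q * Q]QQ subrr.
Qed.

Lemma unity_diagonalizable d (X : 'M[F]_d.+1) N :
  (0 < N)%N -> X ^+ N = 1 -> diagonalizable X.
Proof.
move=> N0 XN.
have [rs Ers] := closed_field_poly_normal ('X^N - 1 : {poly F}).
have ld : lead_coef ('X^N - 1 : {poly F}) = 1.
  by rewrite -[1]/(1%:P) lead_coefXnsubC.
rewrite ld scale1r in Ers.
apply: (@diagonalizable_root _ _ rs); last first.
  by rewrite -Ers rmorphB rmorphXn /= horner_mx_X XN rmorph1 subrr.
rewrite -separable_prod_XsubC -Ers separable_Xn_sub_1 //.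
by rewrite pnatr_eq0 -lt0n.
Qed.

Lemma codiagonalizable_basis d (As : seq 'M[F]_d) :
  {in As &, forall A B, comm_mx A B} -> {in As, forall A, diagonalizable A} ->
  exists2 P, P \in unitmx & {in As, forall A, exists D, P *m A = diag_mx D *m P}.
Proof.
move=> cAs dAs; have [P uP /allP/= PD] := (codiagonalizableP As).1 (conj cAs dAs).
exists P => // A /PD/diagonalizable_forPex[D] /(simmxP uP) PA.
by exists D.
Qed.

Lemma mxtrace_conj d (P A : 'M[F]_d) D :
  P \in unitmx -> P *m A = D *m P -> \tr A = \tr D.
Proof.
move=> uP PA; have -> : A = invmx P *m (D *m P) by rewrite -PA mulKmx.
by rewrite mxtrace_mulC mulmxK.
Qed.

(** The product of a column basis and a row basis of an idempotent is the idempotent;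
    the product in the other order is an identity matrix whose size is the rank. *)
Lemma mxtrace_idem d (Q : 'M[F]_d) : Q *m Q = Q -> \tr Q = (\rank Q)%:R.
Proof.
move=> QQ; rewrite -{1}(mulmx_base Q) mxtrace_mulC.
suff -> : row_base Q *m col_base Q = 1%:M by rewrite mxtrace1.
apply: (row_free_inj (row_base_free Q)); rewrite mul1mx -mulmxA.
by apply: (row_full_inj (col_base_full Q)); rewrite mulmxA !mulmx_base QQ.
Qed.

Lemma diag_conj_entry d (P A : 'M[F]_d) e i j :
  P \in unitmx -> P *m A = diag_mx e *m P ->
  (P *m A *m invmx P) i j = e 0 i *+ (i == j).
Proof. by move=> uP ->; rewrite mulmxK // mxE. Qed.

End LinearAlgebra.

Section GroupElements.
Variables (F : numClosedFieldType) (gT : finGroupType) (G : {group gT}).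
Variables (d : nat) (rG : mx_representation F G d).

Lemma repr_diagonalizable g : g \in G -> diagonalizable (rG g).
Proof.
case: d rG => [|d'] rG' Gg.
  by exists 1%:M; rewrite ?unitmx1 //; apply/diagonalizable_forPp => -[].
apply: (@unity_diagonalizable _ _ _ #[g]%g); first exact: order_gt0.
by rewrite -repr_mxX // expg_order repr_mx1.
Qed.

(** The eigenvalues are roots of unity, as [g] has finite order. *)
Lemma repr_eigen_norm g P e :
  g \in G -> P \in unitmx -> P *m rG g = diag_mx e *m P ->
  forall i, `|e 0 i| = 1.
Proof.
move=> Gg uP Pg i.
have PgX n : P *m rG (g ^+ n)%g = diag_mx (map_mx (fun z => z ^+ n) e) *m P.
  elim: n => [|n IHn].
    rewrite expg0 repr_mx1 mulmx1 (_ : map_mx _ _ = const_mx 1).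
      by rewrite diag_const_mx mul1mx.
    by apply/rowP=> j; rewrite !mxE.
  rewrite expgS repr_mxM ?groupX // mulmxA Pg -mulmxA IHn mulmxA mulmx_diag.
  by congr (diag_mx _ *m _); apply/rowP=> j; rewrite !mxE exprS.
have /= := diag_conj_entry i i uP (PgX #[g]%g).
rewrite expg_order repr_mx1 mulmx1 mulmxV // !mxE eqxx !mulr1n => ei.
apply/eqP; rewrite -(@pexpr_eq1 _ _ #[g]%g) ?order_gt0 //.
by rewrite -normrX -ei normr1.
Qed.

Lemma repr_trace_conj g : g \in G -> \tr (rG g^-1%g) = (\tr (rG g))^*.
Proof.
move=> Gg.
have [P uP PD] : exists2 P, P \in unitmx &
    {in [:: rG g], forall A, exists D, P *m A = diag_mx D *m P}.
  apply: codiagonalizable_basis => [A B|A]; rewrite !inE.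
    by move=> /eqP-> /eqP->.
  by move/eqP->; exact: repr_diagonalizable.
have [e Pg] := PD _ (mem_head _ _).
have ne := repr_eigen_norm Gg uP Pg.
have Pg' : P *m rG g^-1%g = diag_mx (map_mx Num.conj e) *m P.
  suff {1}-> : P = diag_mx (map_mx Num.conj e) *m P *m rG g by rewrite repr_mxK.
  rewrite -mulmxA Pg mulmxA mulmx_diag -[LHS]mul1mx -diag_const_mx.
  congr (diag_mx _ *m _); apply/rowP=> i.
  by rewrite !mxE mulrC -normCK ne expr1n.
rewrite (mxtrace_conj uP Pg) (mxtrace_conj uP Pg') !mxtrace_diag rmorph_sum.
by apply: eq_bigr => i _; rewrite mxE.
Qed.

(** In a common eigenbasis the trace is the sum of the eigenvalues of [rG g], of modulus
    1, over the lines on which [Q] is the identity. *)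
Lemma norm_trace_repr_idem g Q :
  g \in G -> Q *m Q = Q -> rG g *m Q = Q *m rG g ->
  `|\tr (rG g *m Q)| <= \tr Q.
Proof.
move=> Gg QQ gQ.
have [P uP PD] : exists2 P, P \in unitmx &
    {in [:: rG g; Q], forall A, exists D, P *m A = diag_mx D *m P}.
  apply: codiagonalizable_basis => [A B|A]; rewrite !inE.
    by move=> /orP[]/eqP-> /orP[]/eqP->; rewrite /comm_mx ?gQ.
  by move=> /orP[]/eqP->; [exact: repr_diagonalizable|exact: idem_diagonalizable].
have [e Pg] := PD _ (mem_head _ _).
have [q PQ] : exists D, P *m Q = diag_mx D *m P by apply: PD; rewrite !inE eqxx orbT.
have ne := repr_eigen_norm Gg uP Pg.
have q01 i : 0 <= q 0 i.
  have PQQ : P *m Q = diag_mx (\row_j (q 0 j * q 0 j)) *m P.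
    by rewrite -{1}QQ mulmxA PQ -mulmxA PQ mulmxA mulmx_diag.
  have := diag_conj_entry i i uP PQQ; rewrite (diag_conj_entry i i uP PQ).
  rewrite !mxE eqxx !mulr1n => /esym/eqP.
  rewrite -subr_eq0 -{3}[q 0 i]mulr1 -mulrBr mulf_eq0 subr_eq0.
  by case/orP=> /eqP->.
rewrite (mxtrace_conj (D := diag_mx e *m diag_mx q) uP); last first.
  by rewrite mulmxA Pg -!mulmxA PQ.
rewrite (mxtrace_conj uP PQ) mulmx_diag !mxtrace_diag.
apply: le_trans (ler_norm_sum _ _ _) _; apply: ler_sum => i _.
by rewrite mxE normrM ne mul1r ger0_norm.
Qed.

End GroupElements.

(** * Irreducible representations over the complex numbers *)

Section FixedProjection.
Variables (F : numClosedFieldType) (gT : finGroupType) (G : {group gT}).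
Variables (d : nat) (rG : mx_representation F G d).

Definition fixproj (H : {set gT}) : 'M[F]_d := #|H|%:R^-1 *: \sum_(h in H) rG h.

Lemma fixproj_mull (H : {group gT}) g :
  H \subset G -> g \in H -> rG g *m fixproj H = fixproj H.
Proof.
move=> /subsetP sHG Hg; rewrite -scalemxAr mulmx_sumr; congr (_ *: _).
rewrite [RHS](reindex_inj (mulgI g)) /=; apply: eq_big => h; first by rewrite groupMl.
by move=> Hh; rewrite repr_mxM ?sHG.
Qed.

Lemma fixproj_mulr (H : {group gT}) g :
  H \subset G -> g \in H -> fixproj H *m rG g = fixproj H.
Proof.
move=> /subsetP sHG Hg; rewrite -scalemxAl mulmx_suml; congr (_ *: _).
rewrite [RHS](reindex_inj (mulIg g)) /=; apply: eq_big => h; first by rewrite groupMr.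
by move=> Hh; rewrite repr_mxM ?sHG.
Qed.

Lemma fixproj_fix (H : {group gT}) m (W : 'M_(m, d)) :
  {in H, forall h, W *m rG h = W} -> W *m fixproj H = W.
Proof.
move=> WH; rewrite -scalemxAr mulmx_sumr (eq_bigr _ WH) sumr_const.
by rewrite -scaler_nat scalerA mulVf ?scale1r // pnatr_eq0 -lt0n cardG_gt0.
Qed.

Lemma fixproj_idem (H : {group gT}) :
  H \subset G -> fixproj H *m fixproj H = fixproj H.
Proof. by move=> sHG; apply: fixproj_fix => h Hh; apply: fixproj_mulr. Qed.

Lemma fixprojJ (H : {group gT}) g :
  H \subset G -> g \in G -> rG g^-1%g *m fixproj H *m rG g = fixproj (H :^ g)%g.
Proof.
move=> /subsetP sHG Gg; rewrite /fixproj cardJg -scalemxAr -scalemxAl; congr (_ *: _).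
rewrite mulmx_sumr mulmx_suml [RHS](reindex_inj (conjg_inj g)) /=.
apply: eq_big => h; first by rewrite memJ_conjg.
by move=> /sHG Gh; rewrite -!repr_mxM ?groupM ?groupV // conjgE mulgA.
Qed.

Lemma fixproj_trace_ge0 (H : {group gT}) : H \subset G -> 0 <= \tr (fixproj H).
Proof. by move=> sHG; rewrite mxtrace_idem ?fixproj_idem ?ler0n. Qed.

End FixedProjection.

Section Irreducible.
Variables (F : numClosedFieldType) (gT : finGroupType) (G : {group gT}).
Variables (d : nat) (rG : mx_representation F G d).
Hypothesis irrG : mx_irreducible rG.

Let absG : mx_absolutely_irreducible rG.
Proof. exact: group_closure_closed_field. Qed.

Lemma mx_irreducible_degree_gt0 : (0 < d)%N.
Proof. by case/mx_irrP: irrG. Qed.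

Let dn0 : d%:R != 0 :> F.
Proof. by rewrite pnatr_eq0 -lt0n mx_irreducible_degree_gt0. Qed.

Lemma irr_scalar (A : 'M[F]_d) :
  {in G, forall g, A *m rG g = rG g *m A} -> A = (\tr A / d%:R)%:M.
Proof.
move=> cA; have /(mx_abs_irr_cent_scalar absG)/is_scalar_mxP[a ->] : centgmx rG A.
  exact/centgmxP.
by rewrite mxtrace_scalar -[a *+ d]mulr_natr mulfK.
Qed.

(** The average commutes with [G], so it is scalar, and its trace is known. *)
Lemma schur_average (X : 'M[F]_d) :
  \sum_(g in G) rG g^-1%g *m X *m rG g = (#|G|%:R * \tr X / d%:R)%:M.
Proof.
rewrite [LHS]irr_scalar => [|h Gh]; last first.
  rewrite mulmx_suml mulmx_sumr [RHS](reindex_inj (mulIg h)) /=.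
  apply: eq_big => g; first by rewrite groupMr.
  move=> Gg; rewrite invMg !repr_mxM ?groupV // !mulmxA.
  by rewrite -repr_mxM ?groupV // mulgV repr_mx1 mul1mx.
congr (_ / _)%:M; rewrite raddf_sum /= (eq_bigr (fun=> \tr X)).
  by rewrite sumr_const mulr_natl.
by move=> g Gg; rewrite mxtrace_mulC mulmxA -repr_mxM ?groupV // mulgV repr_mx1 mul1mx.
Qed.

(** Schur's average of the elementary matrix (i, j), read at its own entry (i, j) and
    summed over i and j, is the sum of chi(g^-1) chi(g). *)
Lemma sum_norm_char : \sum_(g in G) `|\tr (rG g)| ^+ 2 = #|G|%:R.
Proof.
transitivity (\sum_(g in G) \tr (rG g^-1%g) * \tr (rG g)).
  by apply: eq_bigr => g Gg; rewrite repr_trace_conj // normCK mulrC.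
transitivity (\sum_(g in G) \sum_(i < d) \sum_(j < d)
     (rG g^-1%g *m delta_mx i j *m rG g) i j).
  apply: eq_bigr => g _; rewrite /mxtrace big_distrlr /=.
  apply: eq_bigr => i _; apply: eq_bigr => j _.
  rewrite -(mul_delta_mx (0 : 'I_1)) mulmxA -colE -mulmxA -rowE.
  by rewrite mxE big_ord1 !mxE.
rewrite exchange_big /= (eq_bigr (fun=> #|G|%:R / d%:R)) => [|i _].
  by rewrite sumr_const card_ord -[_ *+ d]mulr_natr mulfVK.
rewrite exchange_big /= (bigD1 i) //= [X in _ + X]big1 => [|j ji].
  rewrite addr0 -summxE schur_average mxE eqxx mulr1n.
  rewrite -(mul_delta_mx (0 : 'I_1)) mxtrace_mulC mul_delta_mx.
  by rewrite /mxtrace big_ord1 mxE !eqxx mulr1.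
by rewrite -summxE schur_average !mxE eq_sym (negPf ji) mulr0n.
Qed.

(** Only the conjugacy class of [g] is kept in the orthogonality relation. *)
Lemma norm_char_le_cent g : g \in G -> `|\tr (rG g)| ^+ 2 <= #|'C_G[g]%g|%:R.
Proof.
move=> Gg; have cG : (#|g ^: G|%g * #|'C_G[g]%g| = #|G|)%N.
  by rewrite mulnC -index_cent1 Lagrange ?subsetIl.
have n0 : (0 : F) < #|g ^: G|%g%:R.
  by rewrite ltr0n; apply/card_gt0P; exists g; exact: class_refl.
rewrite -(ler_pM2l n0) -natrM cG -sum_norm_char.
have /setIidPr <- : (g ^: G)%g \subset G by rewrite class_subG.
rewrite (big_setID (g ^: G)%g) /= mulr_natl -sumr_const.
rewrite -[leLHS]addr0 lerD ?sumr_ge0 //; last by move=> h _; rewrite exprn_ge0.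
rewrite le_eqVlt; apply/orP; left; apply/eqP; apply: eq_bigr => h.
rewrite inE => /andP[Gh /imsetP[k Gk ->]]; congr (`|_| ^+ 2).
by rewrite conjgE !repr_mxM ?groupM ?groupV // mxtrace_mulC -mulmxA -repr_mxM ?groupV // mulgV repr_mx1 mulmx1.
Qed.

(** With [P] the projection on the [H]-fixed vectors, the matrices
    [row_base P *m rG g] span all matrices of that shape, because the [rG g] span the
    full matrix algebra; and they only depend on the coset of [g] modulo [H]. *)
Lemma degree_fixed_le_index (H : {group gT}) :
  H \subset G -> (d * \rank (fixproj rG H) <= #|G : H|%g)%N.
Proof.
move=> sHG; set P := fixproj rG H; set f := \rank P; set B := row_base P.
have BH h : h \in H -> B *m rG h = B.
  move=> Hh; have /submxP[W ->] : (B <= P)%MS by rewrite eq_row_base.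
  by rewrite -mulmxA fixproj_mulr.
pose M := \matrix_(i < #|rcosets H G|) mxvec (B *m rG (repr (enum_val i))).
suff : row_full M.
  by move=> /eqP Er; have := rank_leq_row M; rewrite Er mulnC.
rewrite -sub1mx; apply/row_subP => i; move: (row i _) => v.
rewrite -[v]vec_mxK; move: (vec_mx v) => Y.
have [_ [a aE]] := mx_abs_irrP absG.
have -> : Y = B *m (pinvmx B *m Y) by rewrite mulmxA mulmxVp ?mul1mx ?row_base_free.
rewrite [pinvmx B *m Y]aE mulmx_sumr linear_sum summx_sub // => g Gg.
rewrite -scalemxAr linearZ scalemx_sub //.
have cg : (H :* g)%g \in rcosets H G by apply/rcosetsP; exists g.
have [h Hh Er] : exists2 h, h \in H & repr (H :* g)%g = (h * g)%g.
  by apply/rcosetP; exact: mem_repr_rcoset.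
have -> : B *m rG g = B *m rG (repr (H :* g)%g).
  by rewrite Er repr_mxM ?mulmxA ?(BH h Hh) //; apply: (subsetP sHG).
apply: submx_trans (row_sub (enum_rank_in cg (H :* g)%g) M).
by rewrite rowK enum_rankK_in.
Qed.

End Irreducible.

(** * The trace of a permutation on juntas *)

Section Permutations.
Variable T : finType.
Implicit Types (A B S : {set T}) (s g : {perm T}).

Lemma SymJ A g : (Sym A :^ g)%g = Sym (g @: A).
Proof.
apply/setP => s; rewrite mem_conjg !inE; apply/subsetP/subsetP => H x.
  rewrite !inE => sx; rewrite -[x](permKV g); apply: imset_f; apply: H.
  by rewrite inE permJ (inj_eq perm_inj) ?invgK ?permKV.
rewrite !inE => sx; have : g x \in g @: A.
  apply: H; rewrite inE; apply: contra sx => /eqP sgx.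
  by rewrite -[x](permK g) permJ sgx.
by rewrite mem_imset //; exact: perm_inj.
Qed.

(** Built one value at a time: a permutation right so far is corrected at [j] by a
    transposition, which moves none of the values already settled. *)
Lemma extend_injections (J : finType) (p p' : J -> T) :
  injective p -> injective p' -> exists s, forall j, s (p j) = p' j.
Proof.
move=> ip ip'; suff: forall r : seq J, uniq r -> exists s, {in r, forall j, s (p j) = p' j}.
  case/(_ (enum J) (enum_uniq J)) => s Hs; exists s => j.
  by apply: Hs; rewrite mem_enum.
elim=> [|j r IH] /=; first by exists 1%g.
case/andP=> jr /IH[s Hs]; exists (s * tperm (s (p j)) (p' j))%g => i.
rewrite inE permM => /predU1P[->|ir]; first by rewrite tpermL.
have ij : i != j by apply: contraNneq jr => <-.
rewrite tpermD; first exact: Hs.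
  by rewrite (inj_eq perm_inj) (inj_eq ip) eq_sym.
by rewrite Hs // (inj_eq ip') eq_sym.
Qed.

Lemma perm_of_card A B : #|A| = #|B| -> exists s, s @: A = B.
Proof.
move=> AB; pose p (i : 'I_#|A|) := enum_val i.
pose p' (i : 'I_#|A|) := enum_val (cast_ord AB i).
have ip : injective p by exact: enum_val_inj.
have ip' : injective p' by move=> i j /enum_val_inj/cast_ord_inj.
have [s sp] := extend_injections ip ip'.
exists s; apply/eqP; rewrite eqEcard (card_imset _ perm_inj) AB leqnn andbT.
apply/subsetP => _ /imsetP[x Ax ->]; rewrite -(enum_rankK_in Ax Ax) sp.
exact: enum_valP.
Qed.

Definition exits g A := [set a in A | g a \notin A].

Lemma exits0_stab g A : #|exits g A| = 0%N -> g @: A = A.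
Proof.
move/eqP; rewrite cards_eq0 => /eqP gA; apply/eqP.
rewrite eqEcard (card_imset _ perm_inj) leqnn andbT.
apply/subsetP => _ /imsetP[x Ax ->]; apply/negPn/negP => gx.
by have := in_set0 x; rewrite -gA inE Ax gx.
Qed.

(** Both numbers are [#|A|] minus the number of points of [A] that stay in [A]. *)
Lemma card_entries g A : #|[set b in ~: A | g b \in A]| = #|exits g A|.
Proof.
have kA : #|A| = #|g @^-1: A| by rewrite -im_permV (card_imset _ perm_inj).
have := cardsID A (g @^-1: A); have := cardsID (g @^-1: A) A.
rewrite -kA [A :&: _]setIC => {1}<- /addnI.
rewrite (_ : _ :\: A = [set b in ~: A | g b \in A]); last first.
  by apply/setP => x; rewrite !inE.
by move->; apply: eq_card => x; rewrite !inE andbC.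
Qed.

Lemma card_exits_le g A : (#|exits g A| <= #|T| - #|A|)%N.
Proof.
have <- : #|~: A| = (#|T| - #|A|)%N by rewrite cardsCs setCK.
rewrite -card_entries; apply: subset_leq_card.
by apply/subsetP => x; rewrite inE => /andP[].
Qed.

(** The exchange step of the induction on the number of exits: prepending a transposition
    of an exiting point and an entering point removes one exit. *)
Lemma exits_tperm g A r b :
  r \in exits g A -> b \notin A -> g b \in A ->
  exits (tperm r b * g)%g A = exits g A :\ r.
Proof.
rewrite inE => /andP[Ar gr] bA gb; apply/setP => x; rewrite !inE permM.
have [->|xr] := eqVneq x r; first by rewrite tpermL gb andbF.
have [->|xb] := eqVneq x b; first by rewrite (negPf bA) andbF.
by rewrite tpermD // eq_sym.
Qed.

End Permutations.

Section SymmetricRep.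
Variables (F : numClosedFieldType) (T : finType) (d : nat).
Variable rG : mx_representation F [set: {perm T}]%G d.
Implicit Types (A B S : {set T}) (s g : {perm T}).
Let n := #|T|.

(** Row vectors in the image of [junta A] are those fixed by all permutations which fix
    [A] pointwise; in a module of functions of injections they are the functions that
    only depend on the values at [A]. *)
Definition junta A := fixproj rG (Sym (~: A)).

Lemma junta_idem A : junta A *m junta A = junta A.
Proof. by apply: fixproj_idem; exact: subsetT. Qed.

Lemma juntaJ A g : rG g^-1%g *m junta A *m rG g = junta (g @: A).
Proof.
rewrite /junta fixprojJ ?subsetT ?inE // SymJ; congr (fixproj _ (Sym _)).
by apply/setP => x; rewrite !inE -!preim_permV !inE.
Qed.

Lemma junta_trace_eq A B : #|A| = #|B| -> \tr (junta A) = \tr (junta B).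
Proof.
move=> /perm_of_card[s <-]; rewrite -juntaJ mxtrace_mulC mulmxA -repr_mxM ?inE //.
by rewrite mulgV repr_mx1 mul1mx.
Qed.

(** Up to a factor this is [junta (A :\ r)], written as a sum over the cosets of the
    permutations of [~: A] in those of [r |: ~: A]; the coset of [g] is given by [g r]. *)
Lemma junta_exchange A r :
  r \in A -> junta (A :\ r) = 0 ->
  \sum_(b in r |: ~: A) junta A *m rG (tperm r b) = 0.
Proof.
move=> Ar /eqP; rewrite /junta /fixproj scaler_eq0 invr_eq0 pnatr_eq0.
rewrite -[#|_| == 0%N]negbK -lt0n cardG_gt0 /= setCD setUC => /eqP Q0.
under eq_bigr do rewrite -scalemxAl.
rewrite -scaler_sumr; apply/eqP; rewrite scaler_eq0; apply/orP; right.
move: Q0; set D := r |: ~: A => /eqP Q0.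
rewrite (_ : \sum_(b in D) _ = \sum_(h in Sym D) rG h) ?Q0 //; symmetry.
rewrite (partition_big (fun g => g r) (mem D)) => [|g /=]; last first.
  by rewrite inE => gD; rewrite (perm_closed _ gD) !inE eqxx.
apply: eq_bigr => b Db; rewrite mulmx_suml [LHS](reindex_inj (mulIg (tperm r b))) /=.
have tD : tperm r b \in Sym D.
  rewrite inE; apply/subsetP => x; rewrite inE; apply: contraR => xD.
  by rewrite tpermD //; apply: contraNneq xD => <-; rewrite // !inE eqxx.
apply: eq_big => h; last by rewrite repr_mxM ?inE.
rewrite groupMr // permM -[X in _ == X](tpermL r b) (inj_eq perm_inj).
rewrite !inE; apply/andP/subsetP => [[/subsetP H /eqP hr] x hx|H].
  have := H x hx; rewrite !inE => /predU1P[xr|//].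
  by move: hx; rewrite xr !inE hr eqxx.
split; first by apply/subsetP => x /H; rewrite !inE => ->; rewrite orbT.
by apply: contraT => hr; have := H r; rewrite !inE Ar => /(_ hr).
Qed.

(** Induction on the number [t] of exits. If [r] exits, apply [junta_exchange] and
    multiply by [g]: the terms where [b] is sent outside [A] all have the same trace as
    [g] itself, since there [tperm r b * g] differs from [g] by a permutation of [~: A],
    and the [t] others, those where [b] enters [A], have one exit less. There are
    [n - #|A| - t + 1] equal terms, which is what the recurrence of the binomial
    coefficients asks for. *)
Lemma norm_trace_junta A g :
  (forall r, r \in A -> junta (A :\ r) = 0) ->
  'C(n - #|A|, #|exits g A|)%:R * `|\tr (rG g *m junta A)| <= \tr (junta A).
Proof.
move=> minA; have [t] : exists t, #|exits g A| = t by exists #|exits g A|.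
elim: t g => [|t IHt] g tg.
  rewrite tg bin0 mul1r; apply: norm_trace_repr_idem; rewrite ?inE ?junta_idem //.
  rewrite -{1}(exits0_stab tg) -juntaJ !mulmxA -repr_mxM ?inE //.
  by rewrite mulgV repr_mx1 mul1mx.
have [r rg] : exists r, r \in exits g A by apply/card_gt0P; rewrite tg.
have [Ar gr] : r \in A /\ g r \notin A by move: rg; rewrite inE => /andP[].
have := congr1 (fun X => \tr (X *m rG g)) (junta_exchange Ar (minA r Ar)).
rewrite mul0mx mxtrace0 mulmx_suml raddf_sum /=.
under eq_bigr do rewrite -mulmxA -repr_mxM ?inE // mxtrace_mulC.
set x := \tr (rG g *m _).
rewrite (bigID (fun b => g b \in A)) /=.
rewrite [X in _ + X](eq_bigr (fun=> x)) => [|b /andP[Db gb]]; last first.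
  (* both [g r] and [g b] lie outside [A], so this transposition is absorbed by [junta A] *)
  rewrite (_ : tperm r b * g = g * tperm (g r) (g b))%g; last first.
    by rewrite -tpermJ conjgE !mulgA mulgV mul1g.
  rewrite repr_mxM ?inE // -mulmxA; congr (\tr (_ *m _)).
  apply: fixproj_mull; rewrite ?subsetT // inE; apply/subsetP => y.
  rewrite !inE; apply: contraR; rewrite negbK => Ay.
  by rewrite tpermD //; [move: gr | move: gb]; apply: contraNneq => ->.
rewrite sumr_const => /eqP; rewrite addrC addr_eq0 => /eqP Ex.
set c := #|_| in Ex.
have Ec : c = (n - #|A| - t)%N.
  rewrite /c; pose E := [set b in r |: ~: A | g b \in A].
  have -> : #|[pred i in r |: ~: A | g i \notin A]| = #|(r |: ~: A) :\: E|.
    by apply: eq_card => b; rewrite !inE; case: (b == r); case: (b \in A); case: (g b \in A).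
  have EE : E = [set b in ~: A | g b \in A].
    apply/setP => b; rewrite !inE.
    by have [->|] //= := eqVneq b r; rewrite (negPf gr) !andbF.
  rewrite cardsDS ?EE; last by apply/subsetP => b; rewrite !inE => /andP[->]; rewrite orbT.
  rewrite card_entries tg cardsU1 !inE Ar add1n subSS.
  by rewrite [#|~: A|]cardsCs setCK.
have bound b : b \in r |: ~: A -> g b \in A ->
    'C(n - #|A|, t)%:R * `|\tr (rG (tperm r b * g)%g *m junta A)| <= \tr (junta A).
  rewrite !inE => /predU1P[-> /(negP gr)//|bA gb].
  have te : #|exits (tperm r b * g) A| = t.
    by apply: succn_inj; rewrite -tg exits_tperm // [RHS](cardsD1 r) rg.
  by rewrite -{1}te IHt // te.
have t0 : (0 : F) < t.+1%:R by rewrite ltr0n.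
rewrite -(ler_pM2l t0) tg mulrA -natrM mul_bin_left -Ec natrM -mulrA mulrCA.
rewrite [c%:R * _]mulr_natl -normrMn Ex normrN.
apply: le_trans (ler_wpM2l (ler0n _ _) (ler_norm_sum _ _ _)) _.
rewrite mulr_sumr.
have le_b b : (b \in r |: ~: A) && (g b \in A) ->
    'C(n - #|A|, t)%:R * `|\tr (rG (tperm r b * g)%g *m junta A)| <= \tr (junta A).
  by case/andP; exact: bound.
apply: le_trans (ler_sum _ le_b) _; rewrite sumr_const -[leLHS]mulr_natl.
rewrite ler_wpM2r ?fixproj_trace_ge0 ?subsetT // ler_nat.
rewrite -tg -card_entries; apply: subset_leq_card; apply/subsetP => b.
by rewrite unfold_in !inE => /andP[/orP[/eqP->|->//]]; rewrite (negPf gr).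
Qed.

End SymmetricRep.

(** * Degree and character ratio at a given level *)

Section Level.
Variables (F : numClosedFieldType) (T : finType) (d : nat).
Variable rG : mx_representation F [set: {perm T}]%G d.
Hypothesis irrG : mx_irreducible rG.
Local Notation n := #|T|.
Local Notation junta := (junta rG).

(** One nonzero [junta A] is enough: all sets of size [k] are conjugate, as
    [junta_trace_eq] records. *)
Definition has_level k :=
  (exists2 A : {set T}, #|A| = k & junta A != 0) /\ forall B : {set T}, (#|B| < k)%N -> junta B = 0.

Lemma level_exists B : junta B != 0 -> exists2 k, (k <= #|B|)%N & has_level k.
Proof.
move=> QB; pose P k := [exists A : {set T}, (#|A| == k) && (junta A != 0)].
have exP : exists k, P k by exists #|B|; apply/existsP; exists B; rewrite eqxx.
case: (ex_minnP exP) => k /existsP[A /andP[/eqP Ak QA]] mink; exists k.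
  by apply: mink; apply/existsP; exists B; rewrite eqxx.
split=> [|C Ck]; first by exists A.
apply/eqP; apply: contraLR Ck => QC; rewrite -leqNgt.
by apply: mink; apply/existsP; exists C; rewrite eqxx.
Qed.

Variable k : nat.
Hypothesis lev : has_level k.

Lemma level_trace : exists2 f, (0 < f)%N &
  forall A : {set T}, #|A| = k -> \tr (junta A) = f%:R /\ \rank (junta A) = f.
Proof.
have [[A0' A0k QA0] _] := lev; exists (\rank (junta A0')) => [|A Ak].
  by rewrite lt0n mxrank_eq0.
have E : \tr (junta A) = (\rank (junta A0'))%:R.
  by rewrite (junta_trace_eq _ (B := A0')) ?A0k // mxtrace_idem // junta_idem.
split=> //; apply/eqP; rewrite -(eqr_nat F) -E mxtrace_idem //.
exact: junta_idem.
Qed.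

Lemma level_le_card : (k <= n)%N.
Proof. by have [[A <- _] _] := lev; exact: max_card. Qed.

Lemma sum_junta f : (forall A : {set T}, #|A| = k -> \tr (junta A) = f%:R) ->
  \sum_(A : {set T} | #|A| == k) junta A = ('C(n, k)%:R * f%:R / d%:R)%:M.
Proof.
move=> Qf; rewrite [LHS](irr_scalar irrG) => [|g _]; last first.
  rewrite mulmx_suml mulmx_sumr [RHS](reindex_inj (imset_inj (perm_inj (s := g)))) /=.
  apply: eq_big => A; first by rewrite (card_imset _ perm_inj).
  move=> _; rewrite -juntaJ !mulmxA -repr_mxM ?inE //.
  by rewrite mulgV repr_mx1 mul1mx.
congr (_ / _)%:M; rewrite raddf_sum /= (eq_bigr (fun=> f%:R)) => [|A /eqP]; last exact: Qf.
by rewrite sumr_const mulr_natl -(card_draws T k) cardsE.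
Qed.

(** The sum of the [junta A] is the scalar 'C(n, k) f / d, so multiplying by [rG g] and
    taking traces expresses the character through the traces of [norm_trace_junta]. The
    rank [f] cancels. *)
Lemma char_ratio_le g :
  'C(n, k)%:R * `|\tr (rG g)| <=
    d%:R * \sum_(A : {set T} | #|A| == k) 'C(n - k, #|exits g A|)%:R^-1.
Proof.
have [f f0 Qf] := level_trace; have Qt A Ak := (Qf A Ak).1.
have d0 : (0 : F) < d%:R by rewrite ltr0n (mx_irreducible_degree_gt0 irrG).
have fp : (0 : F) < f%:R by rewrite ltr0n.
have : ('C(n, k)%:R * f%:R / d%:R) * \tr (rG g) =
    \sum_(A : {set T} | #|A| == k) \tr (rG g *m junta A).
  rewrite -raddf_sum -mulmx_sumr (sum_junta Qt) scalar_mxC mul_scalar_mx.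
  by rewrite /= mxtraceZ.
move/(congr1 Num.norm); rewrite normrM => E.
set S := \sum_(A | _) _; rewrite -(ler_pM2l (divr_gt0 fp d0)).
have -> : f%:R / d%:R * (d%:R * S) = f%:R * S by rewrite mulrA divfK ?gt_eqF.
have -> : f%:R / d%:R * ('C(n, k)%:R * `|\tr (rG g)|) =
          `|'C(n, k)%:R * f%:R / d%:R| * `|\tr (rG g)|.
  rewrite [X in _ = X * _]ger0_norm; first by ring.
  by rewrite divr_ge0 ?mulr_ge0 ?ler0n.
rewrite E; apply: le_trans (ler_norm_sum _ _ _) _.
rewrite mulr_sumr; apply: ler_sum => A /eqP Ak.
have tk : (#|exits g A| <= n - k)%N by rewrite -Ak card_exits_le.
rewrite ler_pdivlMr ?ltr0n ?bin_gt0 // mulrC -(Qt A Ak) -{1}Ak.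
apply: norm_trace_junta => r rA; apply: lev.2.
by rewrite -Ak [X in (_ < X)%N](cardsD1 r) rA.
Qed.

(** The sum of the [junta A] is a nonzero scalar, so their images span the module. *)
Lemma degree_le_bin f : (forall A : {set T}, #|A| = k -> \rank (junta A) = f) ->
  (0 < f)%N -> (d <= 'C(n, k) * f)%N.
Proof.
move=> Qf f0; have dp := mx_irreducible_degree_gt0 irrG.
have tQ (A : {set T}) : #|A| = k -> \tr (junta A) = f%:R.
  by move=> Ak; rewrite mxtrace_idem ?junta_idem // Qf.
have := congr1 mxrank (sum_junta tQ); rewrite -scalemx1 mxrank_scale_nz; last first.
  by rewrite mulf_neq0 ?mulf_neq0 ?invr_eq0 ?pnatr_eq0 -?lt0n ?bin_gt0 ?level_le_card.
rewrite mxrank1 => <-.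
have -> : ('C(n, k) * f = \sum_(A : {set T} | #|A| == k) \rank (junta A))%N.
  rewrite (eq_bigr (fun=> f)) => [|A /eqP/Qf //].
  by rewrite sum_nat_const -(card_draws T k) cardsE.
elim/big_rec2: _ => [|A m X _ le_m]; first by rewrite mxrank0.
by apply: leq_trans (mxrank_add _ _) _; rewrite leq_add2l.
Qed.

Lemma fixed_dim_le (A : {set T}) : #|A| = k -> (d * \rank (junta A) <= n ^_ k)%N.
Proof.
move=> Ak; have := degree_fixed_le_index irrG (subsetT (Sym (~: A))).
rewrite -divgS ?subsetT // card_Sym.
have -> : #|[set: {perm T}]| = n`!.
  by rewrite -[n]cardsT -card_Sym; apply: eq_card => s; rewrite !inE; apply/esym/subsetP => x.
have -> : #|~: A| = (n - k)%N by rewrite cardsCs setCK Ak.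
by rewrite ffact_factd ?level_le_card.
Qed.

(** The two bounds pull in opposite directions in the rank f: d <= 'C(n, k) f and
    d f <= n^k. Multiplying them eliminates f. *)
Lemma degree_sqr_le : (d ^ 2 <= 'C(n, k) * n ^ k)%N /\ (d <= n ^ k)%N.
Proof.
have [f f0 Qf] := level_trace; have [[A Ak _] _] := lev.
have := fixed_dim_le Ak; rewrite (Qf A Ak).2 => dfn.
have nk : (n ^_ k <= n ^ k)%N.
  rewrite -[X in (_ <= _ ^ X)%N](card_ord k) -prod_nat_const ffact_prod.
  by apply: leq_prod => i _; exact: leq_subr.
split; last by apply: leq_trans nk; apply: leq_trans dfn; rewrite leq_pmulr.
apply: leq_trans (_ : 'C(n, k) * (d * f) <= _)%N; last first.
  by rewrite leq_mul2l (leq_trans dfn nk) orbT.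
rewrite mulnCA expnS expn1 leq_mul2l; apply/orP; right.
by apply: degree_le_bin => // B /Qf[].
Qed.

End Level.

(** * Weights for disjoint transpositions *)

Lemma leq_bin_unimodal N t s : (t <= s)%N -> (s + t <= N)%N -> ('C(N, t) <= 'C(N, s))%N.
Proof.
have mono i j : (i <= j)%N -> (j.*2 <= N)%N -> ('C(N, i) <= 'C(N, j))%N.
  elim: j => [|j IH]; first by rewrite leqn0 => /eqP->.
  rewrite leq_eqVlt => /predU1P[-> //|ij] jN.
  apply: leq_trans (IH ij _) _; first by apply: leq_trans jN; rewrite leq_double.
  rewrite -(leq_pmul2l (ltn0Sn j)) mul_bin_left leq_mul2r.
  by apply/orP; right; move: jN; rewrite -addnn; lia.
move=> ts sN; have [sh|sh] := leqP s.*2 N; first exact: mono.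
have le_sN : (s <= N)%N by lia.
by rewrite -[X in (_ <= X)%N]bin_sub //; apply: mono; move: sh; rewrite -?addnn; lia.
Qed.

Section PermFix.
Variables (F : fieldType) (T : finType) (d : nat).
Variable rG : mx_representation F [set: {perm T}]%G d.

(** Transpositions generate the symmetric group of [D]: each one used makes one more
    point fixed. *)
Lemma Sym_fix (D : {set T}) (v : 'rV[F]_d) :
  {in D &, forall x y, v *m rG (tperm x y) = v} ->
  {in Sym D, forall h, v *m rG h = v}.
Proof.
move=> vD h; have [m] := ubnP #|[set x | h x != x]|.
elim: m h => // m IHm h; rewrite ltnS => hm Dh.
have [/eqP h0|[x]] := set_0Vmem [set x | h x != x].
  suff -> : h = 1%g by rewrite repr_mx1 mulmx1.
  apply/permP => x; rewrite perm1; apply/eqP/negPn/negP => hx.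
  by have := in_set0 x; rewrite -(eqP h0) inE hx.
rewrite inE => hx; have Dx : x \in D.
  by move: Dh; rewrite inE => /subsetP; apply; rewrite inE.
have Dhx : h x \in D by move: Dh; rewrite inE => /perm_closed ->.
pose h' := (h * tperm x (h x))%g.
have hE : h = (h' * tperm x (h x))%g by rewrite /h' -mulgA tperm2 mulg1.
have Dh' : h' \in Sym D.
  rewrite groupM // inE; apply/subsetP => y; rewrite inE; apply: contraR => yD.
  by rewrite tpermD //; apply: contraNneq yD => <-.
rewrite hE repr_mxM ?inE // mulmxA IHm // ?vD //.
apply: leq_trans hm; apply: proper_card; apply/properP; split; last first.
  by exists x; rewrite !inE // /h' permM tpermR eqxx.
apply/subsetP => y; rewrite !inE; apply: contra => /eqP hy.
have yx : y != x by apply: contraNneq hx => <-; rewrite hy.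
rewrite /h' permM hy tpermD // eq_sym //.
by rewrite -{1}hy (inj_eq perm_inj).
Qed.

End PermFix.

Section Pairs.
Variables (F : numClosedFieldType) (T I : finType) (d : nat).
Variable rG : mx_representation F [set: {perm T}]%G d.
Variable pt : I * bool -> T.
Hypothesis pt_inj : injective pt.

Definition swap i := tperm (pt (i, false)) (pt (i, true)).

Lemma swap_comm (g : {perm T}) i : (forall b, g (pt (i, b)) = pt (i, b)) ->
  (swap i * g = g * swap i)%g.
Proof. by move=> gi; rewrite conjgC tpermJ !gi. Qed.

Lemma rep_comm g h : (g * h = h * g)%g -> rG g *m rG h = rG h *m rG g.
Proof. by move=> E; rewrite -!repr_mxM ?inE // E. Qed.

(** Take a nonzero vector [v] changing sign under the transpositions of [S], with [S] as
    large as possible. If a transposition of [x] and [y], away from the pairs of [S],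
    did not fix [v], then [v - v *m rG (tperm x y)] would change sign under it as well;
    moving [x] and [y] to an unused pair would contradict maximality. So [v] is a junta
    on the [2 * #|S|] points of the pairs of [S]. *)
Lemma junta_of_bounded_antisym t :
  (0 < d)%N -> (t <= #|I|)%N ->
  (forall (S : {set I}) (v : 'rV[F]_d), (t <= #|S|)%N ->
     {in S, forall i, v *m rG (swap i) = - v} -> v = 0) ->
  exists2 B : {set T}, (#|B| <= t.-1.*2)%N & junta rG B != 0.
Proof.
move=> d0 tI H.
suff ext m (S : {set I}) (v : 'rV[F]_d) : (t - #|S| <= m)%N -> v != 0 ->
    {in S, forall i, v *m rG (swap i) = - v} ->
    exists2 B : {set T}, (#|B| <= t.-1.*2)%N & junta rG B != 0.
  apply: (ext t set0 (delta_mx 0 (Ordinal d0))); first by rewrite leq_subr.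
    by apply/eqP => /matrixP/(_ 0 (Ordinal d0))/eqP; rewrite !mxE !eqxx oner_eq0.
  by move=> i; rewrite inE.
elim: m S v => [|m IHm] S v tS v0 vS.
  by case/eqP: v0; apply: (H S v) => //; rewrite -subn_eq0 -leqn0.
have [tleS|Slt] := leqP t #|S|; first by case/eqP: v0; exact: (H S v).
pose B : {set T} := pt @: setX S [set: bool].
have cB : #|B| = (#|S|).*2.
  by rewrite card_imset // cardsX cardsT card_bool muln2.
have ptB i b : (pt (i, b) \in B) = (i \in S).
  by rewrite mem_imset // !inE andbT.
have [fixv|] := boolP [forall x in ~: B, forall y in ~: B, v *m rG (tperm x y) == v].
  exists B; first by rewrite cB leq_double -ltnS prednK // (leq_trans _ Slt).
  apply: contraNneq v0 => QB; rewrite -(fixproj_fix (rG := rG) (H := Sym_group (~: B)) (W := v)).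
    by rewrite -/(junta rG B) QB mulmx0.
  apply: Sym_fix => x y Bx By; apply/eqP.
  by move/forall_inP: fixv => /(_ x Bx)/forall_inP/(_ y By).
rewrite negb_forall_in => /exists_inP[x Bx]; rewrite negb_forall_in => /exists_inP[y By].
rewrite eq_sym -subr_eq0; set w := v - _ => w0.
rewrite !inE in Bx By.
have xy : x != y.
  by apply: contraNneq w0 => xy; rewrite /w xy tperm1 repr_mx1 mulmx1 subrr.
have [i0 Si0] : exists i0, i0 \notin S.
  have : (0 < #|~: S|)%N by rewrite cardsCs setCK subn_gt0 (leq_trans Slt).
  by case/card_gt0P => i; rewrite inE; exists i.
set p := pt (i0, false); set q := pt (i0, true).
have pq : p != q by rewrite (inj_eq pt_inj) xpair_eqE andbF.
have [pB qB] : p \notin B /\ q \notin B by rewrite !ptB.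
(* [g] carries x, y to the pair [i0]; the case [y = p] forces the detour through [y'] *)
pose y' := tperm x p y; pose g := (tperm x p * tperm y' q)%g.
have y'p : y' != p by rewrite -[X in _ != X](tpermL x p) (inj_eq perm_inj) eq_sym.
have gx : g x = p by rewrite permM tpermL tpermD // eq_sym.
have gy : g y = q by rewrite permM tpermL.
have y'B : y' \notin B by rewrite /y'; case: tpermP.
have outB z u : z \in B -> u \notin B -> u != z by move=> zB; apply: contraNneq => ->.
have gB z : z \in B -> g z = z.
  by move=> zB; rewrite permM !tpermD ?outB.
have wS i : i \in S -> w *m rG (swap i) = - w.
  move=> Si; rewrite mulmxBl vS // -mulmxA -rep_comm ?mulmxA ?vS // ?mulNmx ?opprB 1?addrC ?opprK //.
  by rewrite swap_comm // => b; rewrite tpermD ?outB ?ptB.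
apply: (IHm (i0 |: S) (w *m rG g)).
- by rewrite cardsU1 Si0 add1n; lia.
- by rewrite mulmx_free_eq0 ?repr_mx_free ?inE.
move=> i; rewrite !inE => /predU1P[->|Si].
  rewrite -mulmxA -repr_mxM ?inE // /swap -/p -/q -gx -gy -tpermJ -conjgC.
  rewrite repr_mxM ?inE // mulmxA mulmxBl -mulmxA -repr_mxM ?inE // tperm2.
  by rewrite repr_mx1 mulmx1 -opprB mulNmx.
rewrite -mulmxA rep_comm ?mulmxA ?wS ?mulNmx //.
by rewrite -swap_comm // => b; rewrite gB ?ptB.
Qed.

Lemma swap_conj (g : {perm T}) i i' :
  (forall b, g (pt (i, b)) = pt (i', b)) -> (swap i * g = g * swap i')%g.
Proof. by move=> gi; rewrite conjgC tpermJ !gi. Qed.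

(** In a common eigenbasis of the swaps each basis vector [j] has a weight [w j], the set
    of the swaps acting by -1. No weight size lies between [t] and [#|I| - t], else
    permuting the pairs would produce too many weights. A transposition commutes with
    all swaps but two, so it changes the size of a weight by at most 2 and cannot cross
    the gap: the small weights span a submodule, which is zero or everything. *)
Lemma small_degree_weights t :
  mx_irreducible rG -> (t.*2 < #|I|)%N -> (d < 'C(#|I|, t))%N ->
  (forall (S : {set I}) (v : 'rV[F]_d), (t <= #|S|)%N ->
     {in S, forall i, v *m rG (swap i) = - v} -> v = 0) \/
  (forall (S : {set I}) (v : 'rV[F]_d), (t <= #|S|)%N ->
     {in S, forall i, v *m rG (swap i) = v} -> v = 0).
Proof.
move=> irrG tI dC.
have [P uP PD] : exists2 P, P \in unitmx &
    {in [seq rG (swap i) | i <- enum I], forall A, exists D, P *m A = diag_mx D *m P}.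
  apply: codiagonalizable_basis => [_ _ /mapP[i _ ->] /mapP[j _ ->]|_ /mapP[i _ ->]]; last first.
    by apply: repr_diagonalizable; rewrite inE.
  apply: rep_comm; have [->//|ij] := eqVneq i j; apply: swap_comm => b.
  by rewrite tpermD // (inj_eq pt_inj) xpair_eqE eq_sym (negPf ij).
have [e Pe] : exists e : I -> 'rV[F]_d, forall i, P *m rG (swap i) = diag_mx (e i) *m P.
  exists (fun i => \row_j (P *m rG (swap i) *m invmx P) j j) => i.
  have [|D E] := PD (rG (swap i)); first by apply: map_f; rewrite mem_enum.
  rewrite [LHS]E; congr (diag_mx _ *m _); apply/rowP => j.
  by rewrite mxE (diag_conj_entry _ _ uP E) eqxx.
have e1 i j : (e i 0 j == 1) || (e i 0 j == -1).
  have sq : P *m 1%:M = diag_mx (\row_j (e i 0 j * e i 0 j)) *m P.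
    rewrite -mulmx_diag -mulmxA -Pe mulmxA -Pe -mulmxA -repr_mxM ?inE // tperm2.
    by rewrite repr_mx1.
  have := diag_conj_entry j j uP sq; rewrite mulmx1 mulmxV // => E.
  rewrite -sqrf_eq1 expr2; apply/eqP; transitivity ((1%:M : 'M[F]_d) j j).
    by rewrite E eqxx mulr1n [RHS]mxE.
  by rewrite mxE eqxx.
pose w j := [set i | e i 0 j == -1].
have n1 : (1 == -1 :> F) = false by rewrite -subr_eq0 opprK -mulr2n pnatr_eq0.
have eE i j : e i 0 j = if i \in w j then -1 else 1.
  by rewrite inE; case/orP: (e1 i j) => /eqP->; rewrite ?eqxx // n1.
have [N PN uN] : exists2 N : {perm T} -> 'M[F]_d,
    (forall g, P *m rG g = N g *m P) & (forall g, N g \in unitmx).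
  exists (fun g => P *m rG g *m invmx P) => g; first by rewrite mulmxKV.
  by rewrite !unitmx_mul uP repr_mx_unit ?inE // unitmx_inv.
have Nw g i i' j j' : (swap i * g = g * swap i')%g -> N g j j' != 0 ->
    (i \in w j) = (i' \in w j').
  move=> E Nj; have : diag_mx (e i) *m N g = N g *m diag_mx (e i').
    apply: (row_free_inj (A := P)); rewrite ?row_free_unit //=.
    rewrite -!mulmxA -PN -Pe !mulmxA -Pe -PN -!mulmxA -!repr_mxM ?inE //.
    by rewrite E.
  move/matrixP/(_ j j'); rewrite mul_diag_mx mul_mx_diag !mxE mulrC => /(mulfI Nj).
  by rewrite !eE; case: ifP => _; case: ifP => _ // /eqP; rewrite ?n1 // eq_sym n1.
(* a weight of middle size would give all sets of that size as weights *)
have mid j : ~~ ((t <= #|w j|) && (#|w j| + t <= #|I|))%N.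
  apply/negP => /andP[tj jt]; move: dC; rewrite ltnNge => /negP; apply.
  apply: leq_trans (leq_bin_unimodal tj jt) _; rewrite -(card_draws I #|w j|).
  apply: leq_trans (_ : #|[set w j' | j' : 'I_d]| <= d)%N; last first.
    by rewrite -[X in (_ <= X)%N]card_ord; exact: leq_imset_card.
  apply: subset_leq_card; apply/subsetP => S; rewrite inE => /eqP /esym /perm_of_card[s wS].
  have pts_inj : injective (fun x : I * bool => pt (s x.1, x.2)).
    by move=> [a b] [a' b'] /pt_inj[/perm_inj-> ->].
  have [g gp] := extend_injections pt_inj pts_inj.
  have [j' Nj] : exists j', N g j j' != 0.
    apply/existsP; rewrite -negb_forall; apply/negP => /forallP N0.
    have : row j (N g) == 0 by apply/eqP/rowP => j'; rewrite !mxE; apply/eqP.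
    rewrite rowE mulmx_free_eq0; last first.
      by rewrite row_free_unit.
    by move/eqP/matrixP/(_ 0 j)/eqP; rewrite !mxE !eqxx oner_eq0.
  apply/imsetP; exists j' => //; rewrite -wS; apply/setP => l.
  rewrite -[l](permKV s) mem_imset; last exact: perm_inj.
  rewrite -(Nw g (s^-1%g l) (s (s^-1%g l)) j j' _ Nj) //.
  by apply: swap_conj => b; rewrite gp.
pose D : 'M[F]_d := diag_mx (\row_j (#|w j| < t)%N%:R).
have Dtr x y : D *m N (tperm x y) = D *m N (tperm x y) *m D.
  apply/matrixP => j j'; rewrite mul_diag_mx mul_mx_diag !mxE.
  have [->|Nj] := eqVneq (N (tperm x y) j j') 0; first by rewrite mulr0 mul0r.
  case tj : (#|w j| < t)%N; last by rewrite !mul0r.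
  suff -> : (#|w j'| < t)%N by rewrite mulr1.
  pose J := [set i | [exists b, (pt (i, b) == x) || (pt (i, b) == y)]].
  have J2 : (#|J| <= 2)%N.
    apply: leq_trans (_ : #|pt @^-1: [set x; y]| <= _)%N.
      apply: leq_trans (leq_imset_card (fun z => z.1) _).
      apply: subset_leq_card; apply/subsetP => i; rewrite inE => /existsP[b ib].
      by apply/imsetP; exists (i, b); rewrite // !inE.
    rewrite -(card_imset _ pt_inj); apply: leq_trans (_ : #|[set x; y]| <= _)%N.
      by apply: subset_leq_card; apply/subsetP => _ /imsetP[z + ->]; rewrite inE.
    by rewrite cards2; case: (_ != _).
  have wJ : w j' \subset w j :|: J.
    apply/subsetP => i wi; rewrite inE; apply/orP.
    have [Ji|Ji] := boolP (i \in J); [by right | left].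
    rewrite (Nw _ i i _ _ _ Nj) //; apply: swap_comm => b.
    move: Ji; rewrite inE negb_exists => /forallP/(_ b); rewrite negb_or => /andP[xb yb].
    by rewrite tpermD // eq_sym.
  have wj' : (#|w j'| <= #|w j| + 2)%N.
    apply: leq_trans (subset_leq_card wJ) _.
    by apply: leq_trans (leq_card_setU _ _) _; rewrite leq_add2l.
  by have := mid j'; rewrite negb_and -!ltnNge => /orP[//|]; move: tI tj wj'; rewrite -addnn; lia.
have modW : mxmodule rG (D *m P).
  apply/mxmoduleP => g _; have [ts -> _] := prod_tpermP g.
  elim: ts => [|[x y] ts IH]; first by rewrite big_nil repr_mx1 mulmx1.
  have step : D *m P *m rG (tperm x y) = D *m N (tperm x y) *m (D *m P).
    by rewrite -mulmxA PN !mulmxA -Dtr.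
  by rewrite big_cons repr_mxM ?inE // mulmxA /= step -(mulmxA (D *m _)) mulmx_sub.
have coord (v : 'rV[F]_d) i (c : F) j : v *m rG (swap i) = c *: v -> (v *m invmx P) 0 j != 0 -> e i 0 j = c.
  move=> vc uj; have : v *m invmx P *m diag_mx (e i) = c *: (v *m invmx P).
    apply: (row_free_inj (A := P)); rewrite ?row_free_unit //=.
    by rewrite -(mulmxA (v *m _)) -Pe mulmxA mulmxKV // vc -scalemxAl mulmxKV.
  move: (v *m invmx P) uj => u uj /matrixP/(_ 0 j).
  by rewrite mul_mx_diag !mxE mulrC => /(mulIf uj).
have v0P (v : 'rV[F]_d) : (forall j, (v *m invmx P) 0 j = 0) -> v = 0.
  move=> v0; rewrite -[v](mulmxKV uP) (_ : v *m _ = 0) ?mul0mx //.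
  by apply/rowP => j; rewrite v0 mxE.
have [/forallP all_lt|] := boolP [forall j, #|w j| < t]%N.
  left => S v tS vS; apply: v0P => j; apply/eqP; apply: contraT => uj.
  have : S \subset w j.
    apply/subsetP => i Si; have := coord v i (-1) j.
    by rewrite scaleN1r inE => ->; rewrite ?vS.
  by move/subset_leq_card; rewrite leqNgt (leq_trans (all_lt j) tS).
rewrite negb_forall => /existsP[j1 j1t].
have D0 : D = 0.
  apply/eqP; apply: contraNT j1t => Dn0.
  have [_ irr] := (mx_irrP rG).1 irrG.
  have : row_full (D *m P).
    by apply: irr => //; rewrite mulmx_free_eq0 ?row_free_unit.
  rewrite row_full_unit unitmx_mul uP andbT unitmxE det_diag unitfE.
  move/prodf_neq0 => /(_ j1 isT); rewrite mxE.
  by case: (_ < t)%N => //; rewrite eqxx.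
right => S v tS vS; apply: v0P => j; apply/eqP; apply: contraT => uj.
have jt : (t <= #|w j|)%N.
  rewrite leqNgt; apply/negP => jt; have /matrixP/(_ j j)/eqP := D0.
  by rewrite !mxE eqxx jt mulr1n oner_eq0.
have : S \subset ~: w j.
  apply/subsetP => i Si; have := coord v i 1 j.
  by rewrite scale1r !inE => ->; rewrite ?vS // n1.
move/subset_leq_card; rewrite [#|~: _|]cardsCs setCK => /(leq_trans tS).
by rewrite leq_subRL ?max_card // => sj; have := mid j; rewrite jt sj.
Qed.

End Pairs.

(** * Low level or large degree *)

Section SignTwist.
Variables (F : numClosedFieldType) (T : finType) (d : nat).
Variable rG : mx_representation F [set: {perm T}]%G d.

Definition sign_mx (g : {perm T}) : 'M[F]_d := (-1) ^+ g *: rG g.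

Lemma sign_mx_repr : mx_repr [set: {perm T}] sign_mx.
Proof.
split=> [|g h _ _]; first by rewrite /sign_mx odd_perm1 expr0 scale1r repr_mx1.
rewrite /sign_mx odd_permM repr_mxM ?inE // -scalemxAl -scalemxAr scalerA.
by rewrite signr_addb.
Qed.
Definition sign_repr := MxRepresentation sign_mx_repr.

Lemma sign_repr_irr : mx_irreducible rG -> mx_irreducible sign_repr.
Proof.
move=> /mx_irrP[d0 irr]; apply/mx_irrP; split=> // U modU; apply: irr.
apply/mxmoduleP => g Gg; have := mxmoduleP modU g Gg.
by rewrite /= /sign_mx -scalemxAr (eqmx_scale _ (_ : (-1) ^+ g != 0)) ?signr_eq0.
Qed.

Lemma norm_trace_sign g : `|\tr (sign_repr g)| = `|\tr (rG g)|.
Proof. by rewrite /= /sign_mx mxtraceZ normrM normr_sign mul1r. Qed.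

End SignTwist.

(** Tensoring with the sign complements the weights, which reduces the case of large
    weights to that of small ones. *)
Lemma low_level_or_degree (F : numClosedFieldType) (T : finType) d
    (rG : mx_representation F [set: {perm T}]%G d) t :
  mx_irreducible rG -> (t.*2 < #|T|./2)%N -> (d < 'C(#|T|./2, t))%N ->
  exists rG' : mx_representation F [set: {perm T}]%G d,
    [/\ mx_irreducible rG', forall g, `|\tr (rG' g)| = `|\tr (rG g)| &
        exists2 k, (k <= t.-1.*2)%N & has_level rG' k].
Proof.
move=> irr tN dC; set N := #|T|./2 in tN dC.
have ptP (x : 'I_N * bool) : (x.1.*2 + x.2 < #|T|)%N.
  case: x => i b /=; apply: leq_trans (_ : N.*2 <= _)%N.
    have := ltn_ord i; rewrite -!addnn; case: b => /=; lia.
  by rewrite -[leqRHS]odd_double_half leq_addl.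
pose pt (x : 'I_N * bool) : T := enum_val (Ordinal (ptP x)).
have pt_inj : injective pt.
  move=> [i b] [j c] /enum_val_inj[] /= E.
  have bc : b = c.
    by have := congr1 odd E; rewrite !oddD !odd_double !addFb !oddb.
  congr (_, _) => //; apply: val_inj; move: E; rewrite bc => /addIn.
  exact: double_inj.
have d0 : (0 < d)%N by apply: (mx_irreducible_degree_gt0 irr).
have tI : (t <= #|'I_N|)%N by rewrite card_ord; move: tN; rewrite -addnn; lia.
have [||antisym|sym] := @small_degree_weights F T 'I_N d rG pt pt_inj t irr.
- by rewrite card_ord.
- by rewrite card_ord.
- have [B Bt QB] := junta_of_bounded_antisym pt_inj d0 tI antisym.
  have [k kB lev] := level_exists QB.
  by exists rG; split=> //; exists k => //; exact: leq_trans Bt.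
have antisym' (S : {set 'I_N}) (v : 'rV[F]_d) : (t <= #|S|)%N ->
    {in S, forall i, v *m sign_repr rG (swap pt i) = - v} -> v = 0.
  move=> tS vS; apply: (sym S) => // i Si; have := vS i Si.
  rewrite /= /sign_mx odd_tperm (inj_eq pt_inj) xpair_eqE andbF expr1 scaleN1r mulmxN.
  exact: oppr_inj.
have [B Bt QB] := junta_of_bounded_antisym pt_inj d0 tI antisym'.
have [k kB lev] := level_exists QB.
exists (sign_repr rG); split.
- exact: sign_repr_irr.
- exact: norm_trace_sign.
- by exists k => //; exact: leq_trans Bt.
Qed.

(** * Counting sets with few exits *)

Definition bin_le (m k : nat) : nat := \sum_(j < k.+1) 'C(m, j).

Lemma bin_le_mono m k l : (k <= l)%N -> (bin_le m k <= bin_le m l)%N.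
Proof.
by move=> kl; rewrite /bin_le -!(big_mkord xpredT (fun j => 'C(m, j)))
  [leqRHS](big_cat_nat _ (n := k.+1)) //= leq_addr.
Qed.

Lemma card_subsets_le (U : finType) (D : {set U}) k :
  #|[set J : {set U} | (J \subset D) && (#|J| <= k)%N]| = bin_le #|D| k.
Proof.
rewrite -sum1_card (partition_big (fun J : {set U} => inord #|J| : 'I_k.+1) xpredT) //=.
apply: eq_bigr => j _; rewrite sum1_card -cards_draws; apply: eq_card => J.
rewrite [in LHS]unfold_in !inE -andbA; congr (_ && _); apply/andP/eqP => [[Jk /eqP <-]|Jj].
  by rewrite inordK.
by rewrite Jj -ltnS ltn_ord; split=> //; apply/eqP/val_inj; rewrite /= inordK.
Qed.

(** This is (n/k)^k <= 'C(n, k). *)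
Lemma leq_expn_bin n k : (k <= n)%N -> (n ^ k <= k ^ k * 'C(n, k))%N.
Proof.
elim: k n => [|k IH] [|n] //; rewrite ltnS => kn.
have := IH n kn; set X := 'C(n, k) => IHn.
have E : (k.+1 * 'C(n.+1, k.+1) = n.+1 * X)%N by rewrite mul_bin_diag.
rewrite expnS [(k.+1 ^ k.+1)%N]expnSr -mulnA E mulnCA leq_mul2l /=.
have [k0|k0] := posnP k; first by rewrite /X k0 bin0.
have h : ((n.+1 * k) ^ k <= (k.+1 * n) ^ k)%N by rewrite leq_exp2r //; lia.
have nk : (0 < k ^ k)%N by rewrite expn_gt0 k0.
rewrite -(leq_pmul2l nk) -expnMn [(k * n.+1)%N]mulnC; apply: leq_trans h _.
by rewrite expnMn mulnCA leq_mul2l IHn orbT.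
Qed.

Section Cycles.
Variables (T : finType) (g : {perm T}).
Implicit Types A Z : {set T}.
Local Notation n := #|T|.
Local Notation m := #|porbits g|.

(** A permutation commuting with [g] is determined by its values at one point of each
    cycle. *)
Lemma card_cent_le : (#|'C_([set: {perm T}])[g]%g| <= n ^ m)%N.
Proof.
have repE (i : 'I_m) : exists x, enum_val i = porbit g x.
  by have /imsetP[x _ ->] := enum_valP i; exists x.
have [x xE] := fin_all_exists repE.
rewrite -[X in (_ <= _ ^ X)%N]card_ord -card_ffun.
pose f (h : {perm T}) : {ffun 'I_m -> T} := [ffun i => h (x i)].
rewrite -(card_in_imset (f := f)) ?max_card // => h1 h2.
rewrite !in_setI => /andP[_ /cent1P c1] /andP[_ /cent1P c2] /ffunP E.
apply/permP => y; have Oy : porbit g y \in porbits g by apply: imset_f.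
pose i := enum_rank_in Oy (porbit g y).
have : y \in porbit g (x i) by rewrite -xE enum_rankK_in // porbit_id.
case/porbitP => l ->; have := E i; rewrite !ffunE => Ei.
have act (h : {perm T}) : commute g h -> h ((g ^+ l)%g (x i)) = (g ^+ l)%g (h (x i)).
  by move=> c; rewrite -!permM (commuteX l (commute_sym c)).
by rewrite !act ?Ei.
Qed.

(** Induction on [k], removing an exit [z] from [A]: the exits become [Z :\ z], plus the
    predecessor of [z] if that belongs to [A], and [A] is recovered by adding [z]. When
    there is no exit, [A] is a union of at most [k] cycles. *)
Lemma card_exits_eq_le k Z :
  (#|[set A : {set T} | (#|A| == k) && (exits g A == Z)]| <= 2 ^ k * bin_le m k)%N.
Proof.
elim: k Z => [|k IHk] Z.
  apply: leq_trans (_ : #|[set (set0 : {set T})]| <= _)%N.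
    by apply: subset_leq_card; apply/subsetP => A; rewrite !inE cards_eq0 => /andP[].
  by rewrite cards1 /bin_le big_ord1 bin0.
have [->|[z Zz]] := set_0Vmem Z.
  apply: leq_trans (_ : bin_le m k.+1 <= _)%N; last by rewrite leq_pmull ?expn_gt0.
  rewrite -card_subsets_le; pose f A := [set porbit g x | x in A].
  have stab A : exits g A = set0 -> g @: A = A.
    by move=> A0; apply: exits0_stab; rewrite A0 cards0.
  rewrite -(card_in_imset (f := f)) => [|A B].
    apply: subset_leq_card; apply/subsetP => _ /imsetP[A + ->].
    rewrite !inE => /andP[/eqP <- _]; rewrite leq_imset_card andbT.
    by apply/subsetP => _ /imsetP[x _ ->]; exact: imset_f.
  have coverf A' : exits g A' = set0 -> cover (f A') = A'.
    move=> /stab gA; apply/setP => y; apply/bigcupP/idP => [[_ /imsetP[x Ax ->]]|Ay].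
      case/porbitP => i ->; elim: i => [|i IHi]; first by rewrite perm1.
      by rewrite expgSr permM -gA imset_f.
    by exists (porbit g y); rewrite ?porbit_id ?imset_f.
  rewrite !inE => /andP[_ /eqP A0] /andP[_ /eqP B0] E.
  by rewrite -(coverf A A0) -(coverf B B0) E.
have le2 : (#|[set A : {set T} | (#|A| == k.+1) && (exits g A == Z)]| <=
    #|[set A : {set T} | (#|A| == k) && (exits g A == Z :\ z)]| +
    #|[set A : {set T} | (#|A| == k) && (exits g A == (g^-1%g z) |: (Z :\ z))]|)%N.
  apply: leq_trans (leq_card_setU _ _); set U := _ :|: _.
  rewrite -(card_in_imset (f := fun A => A :\ z)) => [|A B].
    apply: subset_leq_card; apply/subsetP => _ /imsetP[A + ->].
    rewrite !inE => /andP[/eqP Ak /eqP AZ].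
    have : z \in exits g A by rewrite AZ.
    rewrite inE => /andP[Az gz]; have -> : #|A :\ z| == k.
      by move: Ak; rewrite (cardsD1 z) Az add1n => -[->].
    rewrite /= -AZ; have [Agz|Agz] := boolP (g^-1%g z \in A); apply/orP; [right|left].
      apply/eqP/setP => x; rewrite !inE -(canF_eq (permK g)) negb_and negbK.
      have [->|xz] := eqVneq x z.
        by rewrite /= orbF; apply/esym/negbTE; apply: contraNneq gz => ->.
      have [gxz|] //= := eqVneq (g x) z.
      by rewrite -(permK g x) gxz Agz.
    apply/eqP/setP => x; rewrite !inE negb_and negbK.
    have [//|xz] := eqVneq x z; have [gxz|] //= := eqVneq (g x) z.
    by move: Agz; rewrite -gxz permK => /negPf->.
  rewrite !inE => /andP[_ /eqP AZ] /andP[_ /eqP BZ] E.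
  have Az : z \in A by move: Zz; rewrite -AZ inE => /andP[].
  have Bz : z \in B by move: Zz; rewrite -BZ inE => /andP[].
  by rewrite -(setD1K Az) -(setD1K Bz) E.
apply: leq_trans le2 _; apply: leq_trans (leq_add (IHk _) (IHk _)) _.
by rewrite addnn -mul2n mulnA -expnS leq_mul2l bin_le_mono ?orbT.
Qed.

End Cycles.

Lemma leq_bin_half n k t : (4 * k <= n)%N -> (t <= k)%N ->
  ('C(n, t) <= 2 ^ t * 'C(n - k, t))%N.
Proof.
move=> kn tk; rewrite -(leq_pmul2r (fact_gt0 t)) -mulnA !bin_ffact.
elim: t tk => [|t IH] tk //; rewrite !ffactnSr expnSr.
rewrite -mulnA [(2 * _)%N]mulnCA mulnA; apply: leq_mul; first exact/IH/ltnW.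
lia.
Qed.

(** There are 'C(n, t) possible sets of [t] exits, and 'C(n, t) <= 2^t 'C(n - k, t), so that
    the weights 1 / 'C(n - k, t) compensate for the choice of the exits. *)
Lemma sum_exits_le (F : numFieldType) (T : finType) (g : {perm T}) k :
  (4 * k <= #|T|)%N ->
  \sum_(A : {set T} | #|A| == k) 'C(#|T| - k, #|exits g A|)%:R^-1
    <= (8 ^ k * bin_le #|porbits g| k)%:R :> F.
Proof.
set n := #|T| => kn; set B := bin_le _ _.
have tk (A : {set T}) : #|A| == k -> (#|exits g A| < k.+1)%N.
  move/eqP=> <-; rewrite ltnS; apply: subset_leq_card; apply/subsetP => x.
  by rewrite inE => /andP[].
rewrite (partition_big (fun A => exits g A) (fun Z => #|Z| < k.+1)%N) //=.
apply: le_trans (_ : \sum_(Z : {set T} | (#|Z| < k.+1)%N)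
   (2 ^ k * B)%:R * 'C(n - k, #|Z|)%:R^-1 <= _).
  apply: ler_sum => Z _.
  rewrite (eq_bigr (fun=> 'C(n - k, #|Z|)%:R^-1)) => [|A /andP[_ /eqP->] //].
  rewrite sumr_const -[leLHS]mulr_natl ler_wpM2r ?invr_ge0 ?ler0n // ler_nat.
  by apply: leq_trans (card_exits_eq_le g k Z); rewrite cardsE.
rewrite -mulr_sumr (partition_big (fun Z : {set T} => inord #|Z| : 'I_k.+1) xpredT) //=.
apply: le_trans (_ : (2 ^ k * B)%:R * (\sum_(t < k.+1) 2 ^ k)%:R <= _).
  rewrite ler_wpM2l ?ler0n // natr_sum; apply: ler_sum => t _.
  rewrite (eq_bigr (fun=> 'C(n - k, t)%:R^-1)) => [|Z /andP[Zk /eqP <-]]; last by rewrite inordK.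
  rewrite sumr_const -[leLHS]mulr_natr mulrC.
  have Cpos : (0 : F) < 'C(n - k, t)%:R.
    by rewrite ltr0n bin_gt0; have := ltn_ord t; lia.
  rewrite ler_pdivrMr // -natrM ler_nat.
  apply: leq_trans (_ : 'C(n, t) <= _)%N.
    rewrite -card_draws; apply: subset_leq_card; apply/subsetP => Z.
    by rewrite unfold_in !inE => /andP[Zk /eqP <-]; rewrite inordK.
  apply: leq_trans (leq_bin_half kn _) _; first by rewrite -ltnS.
  by rewrite leq_mul2r leq_exp2l // -ltnS ltn_ord orbT.
rewrite -natrM ler_nat sum_nat_const card_ord.
rewrite (_ : 8 ^ k = 2 ^ k * (2 ^ k * 2 ^ k))%N; last by rewrite -!expnMn.
rewrite -!mulnA leq_mul2l; apply/orP; right.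
have := ltn_expl k (ltnSn 1); move: (2 ^ k)%N => x kx.
by rewrite mulnC [X in (_ <= X)%N](_ : _ = x * x * B)%N ?mulnA // leq_mul2r leq_mul2r kx !orbT.
Qed.

(** * Numerical estimates *)

Lemma leq_half_mul3 n : (2 <= n)%N -> (n <= n./2 * 3)%N.
Proof.
move=> n2; rewrite -{1}[n]odd_double_half -muln2 (mulnDr _ 1 2) muln1 leq_add2r.
by rewrite (leq_trans (leq_b1 _)) // half_gt0.
Qed.

Section Estimates.
Variable R : realType.
Implicit Types (x y a b : R).

Lemma ln2_bounds : 1 / 2 <= ln (2 : R) <= 1.
Proof.
apply/andP; split; last by have := @le_ln1Dx R 1; rewrite -[1 + 1]/2; apply; lra.
have : ln (1 + - (1 / 2) : R) <= - (1 / 2) by apply: le_ln1Dx; lra.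
rewrite (_ : 1 + - (1 / 2) = 2^-1 :> R); last by lra.
by rewrite lnV ?posrE //; lra.
Qed.

Lemma expR1_le4 : expR 1 <= 4 :> R.
Proof.
have /andP[l2 _] := ln2_bounds.
rewrite -[4]lnK ?posrE // ler_expR (_ : 4 = 2 * 2 :> R); last by lra.
by rewrite lnM ?posrE //; lra.
Qed.

(** Compare with the expansion of (1 + x)^M at x = k/M <= 1, which is at most e^k. *)
Lemma bin_le_bound m M k : (m <= M)%N -> (0 < k <= M)%N ->
  (bin_le m k)%:R <= (4 * M%:R / k%:R) ^+ k :> R.
Proof.
move=> mM /andP[k0 kM]; have M0 : (0 < M)%N by lia.
have kR : 0 < k%:R :> R by rewrite ltr0n.
have MR : 0 < M%:R :> R by rewrite ltr0n.
set x : R := k%:R / M%:R.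
have x0 : 0 < x by rewrite divr_gt0.
have x1 : x <= 1 by rewrite ler_pdivrMr // mul1r ler_nat.
have E : 4 * M%:R / k%:R = 4 / x by rewrite /x; field; lra.
rewrite E expr_div_n ler_pdivlMr ?exprn_gt0 //.
apply: le_trans (_ : (1 + x) ^+ M <= _).
  rewrite exprDn natr_sum mulr_suml.
  rewrite (big_ord_widen_cond M.+1 xpredT (fun j => 'C(m, j)%:R * x ^+ k)) //.
  rewrite [leRHS](bigID (fun j : 'I__ => (j < k.+1)%N)) /= -[leLHS]addr0.
  apply: lerD; last first.
    by apply: sumr_ge0 => i _; rewrite mulrn_wge0 // mulr_ge0 ?exprn_ge0 ?ltW.
  apply: ler_sum => j jk; rewrite expr1n mul1r -[leRHS]mulr_natl.
  apply: ler_pM; rewrite ?ler0n ?exprn_ge0 ?(ltW x0) //.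
    by rewrite ler_nat; exact: leq_bin2l.
  by apply: ler_wiXn2l => //; rewrite ?(ltW x0) // -ltnS.
have := expR_ge1Dx x => xe.
apply: le_trans (_ : expR x ^+ M <= _).
  by apply: lerXn2r; rewrite ?nnegrE ?addr_ge0 ?expR_ge0 ?(ltW x0).
rewrite -expRM_natr /x divfK ?gt_eqF // -[k%:R]mul1r expRM_natr.
by apply: lerXn2r; rewrite ?nnegrE ?expR_ge0 ?expR1_le4.
Qed.

(** The hypotheses force log n > 100; when log n < 1, where log log n is negative, they
    are contradictory because log log n >= - log 2. The last conclusion is
    1 / (1 - a) <= log n. *)
Lemma range_consequences n a : (2 <= n)%N ->
  1 / (100^-1 * ln n%:R) < a -> a < 1 - 64 * ln (ln n%:R) / ln n%:R ->
  let L := ln n%:R in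
  [/\ 0 < a < 1, 100 < a * L, 64 * ln L < (1 - a) * L,
      3 <= ln L & - ln L <= ln (1 - a)].
Proof.
move=> n2; set L := ln n%:R => a1 a2 /=.
have /andP[l2 l2'] := ln2_bounds.
have nR : 2 <= n%:R :> R by rewrite ler_nat.
have L2 : ln 2 <= L by rewrite ler_ln ?posrE ?ltr0n //; lia.
have L0 : 0 < L by lra.
have aL : 100 < a * L.
  by move: a1; rewrite ltr_pdivrMr ?mulr_gt0 ?invr_gt0 // => ?; lra.
have a2' : a * L < L - 64 * ln L.
  by move: a2; rewrite -(ltr_pM2r L0) mulrBl mul1r divfK ?gt_eqF.
have [L1|L1] := ltP L 1.
  have : - ln (2 : R) <= ln L.
    by rewrite -lnV ?posrE // ler_ln ?posrE ?invr_gt0 //; lra.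
  move=> h; nra.
have lL0 : 0 <= ln L by apply: ln_ge0.
have L100 : 100 < L by lra.
have lL : 3 <= ln L.
  apply: le_trans (_ : ln (2 ^+ 6) <= _); first by rewrite lnXn //; lra.
  by rewrite ler_ln ?posrE ?exprn_gt0 //; lra.
have a0 : 0 < a by nra.
have aa1 : a < 1 by nra.
split; rewrite ?a0 ?aa1 //; first by lra.
rewrite -lnV ?posrE // ler_ln ?posrE ?invr_gt0 //; last by lra.
by rewrite -(ler_pM2r L0) mulVf ?gt_eqF //; lra.
Qed.

Section Regime.
Variables (n : nat) (a L : R).
Hypotheses (n2 : (2 <= n)%N) (LE : ln n%:R = L).
Hypotheses (a01 : 0 < a < 1) (aL : 100 < a * L) (bL : 64 * ln L < (1 - a) * L).
Hypotheses (lL : 3 <= ln L) (lb : - ln L <= ln (1 - a)).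
(** The size of the level at which the argument switches from the trace bound on juntas
    to the bound by centralizers. The factor 1 / (1 - a) makes the degree large enough
    above the threshold when [a] is close to 1. *)
Definition threshold := n%:R `^ a / (1 - a).
Local Notation K := threshold.

Lemma regime_powR : n%:R `^ a = expR (a * L).
Proof. by rewrite /powR pnatr_eq0 LE gtn_eqF //; lia. Qed.

Let L100 : 100 < L.
Proof.
have /andP[a0 a1] := a01; have aL0 : 0 < a * L by apply: lt_trans aL.
have L0 : 0 < L by rewrite pmulr_rgt0 in aL0.
apply: lt_trans aL _; rewrite gtr_pMl //.
Qed.

Let b0 : 0 < 1 - a. Proof. by move: a01 => /andP[? ?]; lra. Qed.

Lemma ln_threshold : ln K = a * L - ln (1 - a).
Proof. by rewrite /K regime_powR ln_div ?posrE ?expR_gt0 ?expRK. Qed.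

Lemma threshold_mul : K * (1 - a) = expR (a * L).
Proof. by rewrite /K divfK ?gt_eqF // regime_powR. Qed.

Lemma threshold_ge1 : 1 <= K.
Proof.
rewrite ler_pdivlMr // mul1r regime_powR.
by have := expR_ge1Dx (a * L); have := aL; move: a01 => /andP[? ?]; lra.
Qed.

(** As 1 / (1 - a) <= log n and n^a <= n / (log n)^64. *)
Lemma threshold_le : 100 * K <= n%:R.
Proof.
have K0 : 0 < K by have := threshold_ge1; lra.
have n0 : 0 < n%:R :> R by rewrite ltr0n ltnW.
have l100 : ln (100 : R) <= ln L by rewrite ler_ln ?posrE //; have := L100; lra.
have K100 : 0 < 100 * K by lra.
rewrite -ler_ln ?posrE // lnM ?posrE // ln_threshold LE.
by have := (bL, lL, lb) => -[[? ?] ?]; lra.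
Qed.

(** Since t is about n^a / (1 - a), the logarithm of 'C(n/2, t) is at least of the order of
    t log(n/t), where log(n/t) is about (1 - a) log n: this gives n^a log n, up to a
    constant, against (m / 2) log n for the character. *)
Lemma large_degree_bound m d t (r : R) :
  m%:R <= 100^-1 * a * n%:R `^ a -> K < t%:R -> t%:R <= K + 1 ->
  ('C(n./2, t) <= d)%N -> 0 <= r -> r ^+ 2 <= n%:R ^+ m -> r <= d%:R `^ a.
Proof.
move=> mle Kt tK Cd r0 rn; have K1 := threshold_ge1; have Kn := threshold_le.
have lnK' := ln_threshold; have Kb := threshold_mul.
set X := K in Kt tK K1 Kn lnK' Kb *; clearbody X.
have [aL' bL' lL' lb'] : [/\ 100 < a * L, 64 * ln L < (1 - a) * L, 3 <= ln L & - ln L <= ln (1 - a)] by [].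
have [L1' b1'] := (L100, b0); have /andP[a0 a1] := a01; have /andP[l2 l2'] := ln2_bounds.
have n0 : 0 < n%:R :> R by rewrite ltr0n ltnW.
have [N0 Nn] : 0 < (n./2)%:R :> R /\ n%:R / 3 <= (n./2)%:R :> R.
  split; first by rewrite ltr0n half_gt0.
  by rewrite ler_pdivrMr // -natrM ler_nat leq_half_mul3.
have t0 : 0 < t%:R :> R by lra.
have tN : (t <= n./2)%N by rewrite -(ler_nat R); lra.
have d0 : (0 < d)%N by apply: leq_trans Cd; rewrite bin_gt0.
have dR : 0 < d%:R :> R by rewrite ltr0n.
have lnd : t%:R * (ln (n./2)%:R - ln t%:R) <= ln (d%:R : R).
  have : (n./2)%:R ^+ t <= t%:R ^+ t * d%:R :> R.
    rewrite -!natrX -natrM ler_nat; apply: leq_trans (leq_expn_bin tN) _.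
    by rewrite leq_mul2l Cd orbT.
  rewrite -ler_ln ?posrE ?mulr_gt0 ?exprn_gt0 // lnM ?posrE ?exprn_gt0 // !lnXn //.
  by rewrite -[ln _ *+ _]mulr_natl -[ln t%:R *+ _]mulr_natl mulrBr; lra.
have l3 : ln (3 : R) <= 2.
  apply: le_trans (_ : ln (2 * 2) <= _); first by rewrite ler_ln ?posrE //; lra.
  by rewrite lnM ?posrE //; lra.
have lnN : L - 2 <= ln (n./2)%:R.
  apply: le_trans (_ : ln (n%:R / 3) <= _); first by rewrite ln_div ?posrE // LE; lra.
  by rewrite ler_ln ?posrE ?divr_gt0.
have lnt : ln t%:R <= 1 + a * L - ln (1 - a).
  apply: le_trans (_ : ln (2 * X) <= _); first by rewrite ler_ln ?posrE ?mulr_gt0 //; lra.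
  by rewrite lnM ?posrE //; lra.
have gap : (1 - a) * L / 2 <= ln (n./2)%:R - ln t%:R by lra.
have y0 := expR_gt0 (a * L).
have lndy : expR (a * L) * L / 2 <= ln d%:R.
  apply: le_trans lnd; apply: le_trans (_ : X * ((1 - a) * L / 2) <= _).
    by rewrite !mulrA Kb.
  apply: ler_pM => //; first by lra.
    by rewrite divr_ge0 // mulr_ge0 ?ltW //; lra.
  by lra.
move: r0; rewrite le_eqVlt => /predU1P[<-|r0]; first exact: powR_ge0.
rewrite /powR gt_eqF // -[leLHS]lnK ?posrE // ler_expR.
have lnr : ln r * 2 <= m%:R * L.
  move: rn; rewrite -ler_ln ?posrE ?exprn_gt0 // !lnXn // LE -[leLHS]mulr_natr -[leRHS]mulr_natr; lra.
have mL : m%:R * L <= 100^-1 * a * expR (a * L) * L.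
  by rewrite -regime_powR ler_wpM2r //; lra.
have : a * (expR (a * L) * L / 2) <= a * ln d%:R by rewrite ler_wpM2l // ltW.
have : 0 <= a * (expR (a * L) * L) by rewrite !mulr_ge0 ?ltW //; lra.
lra.
Qed.

(** From the binomial bounds, r <= d (32 M / n)^k where M = max(m, k). If 32 M <= n^a, the
    trivial d <= n^k is enough. Otherwise M = k, as m is much smaller than n^a, and
    d^2 <= (4 n^2 / k)^k is used: it saves a factor k^((1 - a) k / 2), which absorbs the
    excess of k over n^a. *)
Lemma low_level_bound m d k (r : R) :
  m%:R <= 100^-1 * a * n%:R `^ a -> (0 < d)%N -> k%:R <= 2 * K ->
  (d ^ 2 <= 'C(n, k) * n ^ k)%N -> (d <= n ^ k)%N -> 0 <= r ->
  'C(n, k)%:R * r <= d%:R * (8 ^ k * bin_le m k)%:R ->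
  r <= d%:R `^ a.
Proof.
move=> mle d0 kK d2 dn r0 rle; have K1 := threshold_ge1; have Kn := threshold_le.
have lnK' := ln_threshold; have Kb := threshold_mul.
set X := K in kK K1 Kn lnK' Kb *; clearbody X.
have [aL' bL' lL' lb'] : [/\ 100 < a * L, 64 * ln L < (1 - a) * L, 3 <= ln L & - ln L <= ln (1 - a)] by [].
have [L1' b1'] := (L100, b0); have /andP[a0 a1] := a01; have /andP[l2 l2'] := ln2_bounds.
have n0 : 0 < n%:R :> R by rewrite ltr0n ltnW.
have dR : 0 < d%:R :> R by rewrite ltr0n.
have [k0|k0] := posnP k.
  move: dn rle; rewrite k0 expn0 /bin_le big_ord1 !bin0 mul1r muln1 mulr1 => dn.
  have -> : d = 1%N by apply/eqP; rewrite eqn_leq dn d0.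
  by rewrite powR1.
have kR : 0 < k%:R :> R by rewrite ltr0n.
have kn : (k <= n)%N by rewrite -(ler_nat R); lra.
have Ck : n%:R ^+ k <= k%:R ^+ k * 'C(n, k)%:R :> R.
  by rewrite -!natrX -natrM ler_nat leq_expn_bin.
have C0 : 0 < 'C(n, k)%:R :> R by rewrite ltr0n bin_gt0.
pose M := maxn m k.
have M0 : 0 < M%:R :> R by rewrite ltr0n leq_max k0 orbT.
have rho : r <= d%:R * (32 * M%:R / n%:R) ^+ k.
  have BM : (bin_le m k)%:R <= (4 * M%:R / k%:R) ^+ k :> R.
    by apply: bin_le_bound; rewrite ?leq_maxl // k0 leq_maxr.
  rewrite -(ler_pM2l C0); apply: le_trans rle _.
  rewrite mulrCA ler_pM2l // natrM natrX.
  apply: le_trans (ler_wpM2l (exprn_ge0 _ (ler0n _ _)) BM) _.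
  rewrite -exprMn (_ : 8 * _ = 32 * M%:R / k%:R); last by field; lra.
  rewrite !expr_div_n mulrCA ler_wpM2l ?exprn_ge0 ?mulr_ge0 //.
  rewrite -(ler_pM2l (exprn_gt0 k kR)) mulfV ?gt_eqF ?exprn_gt0 // mulrA.
  by rewrite ler_pdivlMr ?exprn_gt0 // mul1r.
have ld0 : 0 <= ln (d%:R : R) by apply: ln_ge0; rewrite ler1n.
apply: le_trans rho _; rewrite -ler_ln ?posrE ?powR_gt0 ?mulr_gt0 ?exprn_gt0 ?divr_gt0 ?mulr_gt0 //.
rewrite ln_powR lnM ?posrE ?exprn_gt0 ?divr_gt0 ?mulr_gt0 // lnXn ?divr_gt0 ?mulr_gt0 //.
rewrite ln_div ?posrE ?mulr_gt0 // lnM ?posrE // LE -[_ *+ k]mulr_natl.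
have l32 : ln (32 : R) <= 5.
  by rewrite (_ : 32 = 2 ^+ 5 :> R) ?lnXn //; [lra | rewrite -natrX].
suff : exists2 Y, ln d%:R <= k%:R * Y & ln 32 + ln M%:R - L <= - (1 - a) * Y.
  case=> Y dY MY.
  have : k%:R * (ln 32 + ln M%:R - L) <= k%:R * (- (1 - a) * Y) by rewrite ler_pM2l.
  have : (1 - a) * ln d%:R <= (1 - a) * (k%:R * Y) by rewrite ler_pM2l.
  nra.
have [My|My] := leP (32 * M%:R) (expR (a * L)).
  exists L; last first.
    by move: My; rewrite -ler_ln ?posrE ?mulr_gt0 ?expR_gt0 // lnM ?posrE // expRK; lra.
  have : d%:R <= n%:R ^+ k :> R by rewrite -natrX ler_nat.
  by rewrite -ler_ln ?posrE ?exprn_gt0 // lnXn // LE mulr_natl.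
have Mk : M = k.
  apply/maxn_idPr; rewrite leqNgt; apply/negP => km.
  have Mm : M = m by apply/maxn_idPl; exact: ltnW.
  by move: My mle; rewrite Mm regime_powR; have := expR_gt0 (a * L); nra.
rewrite Mk in My *.
(* this is the logarithm of (4 n^2 / k)^(1/2) *)
exists ((ln 4 + 2 * L - ln k%:R) / 2).
  have Cn : 'C(n, k)%:R <= (4 * n%:R / k%:R) ^+ k :> R.
    apply: le_trans (bin_le_bound (leqnn n) _); last by rewrite k0.
    by rewrite ler_nat /bin_le big_ord_recr /= leq_addl.
  have d2R : d%:R ^+ 2 <= (4 * n%:R / k%:R) ^+ k * n%:R ^+ k :> R.
    apply: le_trans (_ : 'C(n, k)%:R * n%:R ^+ k <= _).
      by rewrite -!natrX -natrM ler_nat.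
    by rewrite ler_wpM2r // exprn_ge0 // ltW.
  move: d2R; rewrite -exprMn -ler_ln ?posrE ?exprn_gt0 ?mulr_gt0 ?invr_gt0 // !lnXn ?mulr_gt0 ?invr_gt0 //.
  rewrite lnM ?posrE ?divr_gt0 ?mulr_gt0 // ln_div ?posrE ?mulr_gt0 // lnM ?posrE // LE.
  rewrite -[_ *+ k]mulr_natl -[ln _ *+ 2]mulr_natl; lra.
have lk : ln k%:R <= 1 + a * L - ln (1 - a).
  apply: le_trans (_ : ln (2 * X) <= _); first by rewrite ler_ln ?posrE ?mulr_gt0 //; lra.
  by rewrite lnM ?posrE //; lra.
have lk' : a * L - 5 <= ln k%:R.
  by move: My; rewrite -ltr_ln ?posrE ?mulr_gt0 ?expR_gt0 // lnM ?posrE // expRK; lra.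
have l4 : ln (4 : R) <= 2 by rewrite (_ : 4 = 2 * 2 :> R) ?lnM ?posrE //; [lra | rewrite -natrM].
have l4' : 0 <= ln (4 : R) by apply: ln_ge0; lra.
suff : 8 - ln (1 - a) <= (1 - a) * (a * L - 5) / 2.
  by nra.
have [ah|ah] := leP a (1 / 2).
  have : - ln (1 - a) <= 1.
    rewrite -lnV ?posrE //; apply: le_trans l2'; rewrite ler_ln ?posrE ?invr_gt0 //.
    by rewrite -(ler_pM2r b0) mulVf ?gt_eqF //; lra.
  nra.
nra.
Qed.

End Regime.
End Estimates.

(** * The character bound *)

Local Open Scope complex_scope.

(** The two regimes are told apart by whether the degree reaches 'C(n./2, t), with [t] just
    above the threshold. *)
Lemma char_bound (R : realType) (n d : nat) (rG : mx_representation R[i] [set: 'S_n]%G d)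
    (sigma : 'S_n) (a r : R) :
  mx_irreducible rG -> (2 <= n)%N ->
  1 / (100^-1 * ln n%:R) < a -> a < 1 - 64 * ln (ln n%:R) / ln n%:R ->
  (num_cycles sigma)%:R <= 100^-1 * a * n%:R `^ a ->
  `|\tr (rG sigma)| = r%:C -> r <= d%:R `^ a.
Proof.
move=> irr n2 a1 a2 ma rE; set m := num_cycles sigma in ma.
have [a01 aL bL lL lb] := range_consequences n2 a1 a2.
have K1 := threshold_ge1 n2 (erefl _) a01 aL.
have Kn := threshold_le n2 (erefl _) a01 aL bL lL lb.
have natC k : (k%:R : R[i]) = (k%:R)%:C by rewrite rmorph_nat.
have r0 : 0 <= r by rewrite -lecR -rE normr_ge0.
have K0 : 0 <= threshold n a by lra.
have /andP[tK Kt] := Num.Theory.truncn_itv K0.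
set t := (Num.truncn (threshold n a)).+1 in Kt.
have tK1 : t%:R <= threshold n a + 1 by rewrite /t -natr1 lerD2r.
have tn : (t * 50 <= n)%N by rewrite -(ler_nat R) natrM; lra.
have t4 : (t.*2 < n./2)%N by move: tn; rewrite /t; clear; lia.
have [Cd|dC] := leqP 'C(n./2, t) d.
  apply: (large_degree_bound n2 (erefl _) a01 aL bL lL lb ma Kt tK1 Cd r0).
  rewrite -lecR !rmorphXn /= -rE rmorph_nat.
  apply: le_trans (norm_char_le_cent irr (in_setT sigma)) _.
  by rewrite -natrX ler_nat; have := card_cent_le sigma; rewrite card_ord.
have tN : (t.*2 < #|'I_n|./2)%N by rewrite card_ord.
have dC' : (d < 'C(#|'I_n|./2, t))%N by rewrite card_ord.
have [rG' [irr' rG'E [k kt lev]]] := low_level_or_degree irr tN dC'.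
have kK : k%:R <= 2 * threshold n a.
  apply: le_trans (_ : (2 * t.-1)%:R <= _); first by rewrite ler_nat mul2n.
  by rewrite natrM ler_wpM2l.
have kn : (4 * k <= #|'I_n|)%N by rewrite card_ord -(ler_nat R) natrM; lra.
have [d2 dn] := degree_sqr_le irr' lev; rewrite card_ord in d2 dn.
apply: (low_level_bound n2 (erefl _) a01 aL bL lL lb ma _ kK d2 dn r0).
  exact: mx_irreducible_degree_gt0 irr'.
have := char_ratio_le irr' lev sigma; rewrite rG'E rE.
have := sum_exits_le R[i] sigma kn; rewrite card_ord => S1 /le_trans.
move/(_ _ (ler_wpM2l (ler0n _ _) S1)).
by rewrite !natC -!rmorphM /= lecR.
Qed.

Theorem theorem1p8 (R : realType) :
  exists c C : R,
    [/\ 0 < c, 0 < C &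
      forall (n : nat) (alpha : R) (sigma : 'S_n),
        (2 <= n)%N ->
        1 / (c * ln n%:R) < alpha ->
        alpha < 1 - C * ln (ln n%:R) / ln n%:R ->
        (num_cycles sigma)%:R <= c * alpha * n%:R `^ alpha ->
        forall chi : 'S_n -> R[i],
          complex_irr_char [set: 'S_n]%G chi ->
          `|chi sigma / chi 1%g| <= (complex.Re (chi 1%g) `^ (alpha - 1))%:C].
Proof.
(* C only has to beat fixed powers of log n; given C, any c small enough would do *)
exists 100^-1, 64; split; [lra | lra |].
move=> n alpha sigma n2 a1 a2 ma chi [d [rG [irr chiE]]].
have d0 := mx_irreducible_degree_gt0 irr.
have dR : 0 < d%:R :> R by rewrite ltr0n.
have chi1 : chi 1%g = (d%:R : R)%:C.
  by rewrite chiE ?group1 // repr_mx1 mxtrace1 rmorph_nat.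
rewrite chi1 /= chiE ?inE // normrM normfV.
have [r rE] : exists r : R, `|\tr (rG sigma)| = r%:C.
  by rewrite normc_def; eexists.
have le_r := char_bound irr n2 a1 a2 ma rE.
have -> : `|(d%:R : R)%:C| = (d%:R : R)%:C by rewrite ger0_norm // lecR ltW.
rewrite rE -fmorphV -rmorphM lecR ler_pdivrMr //.
have -> : d%:R `^ (alpha - 1) * d%:R = d%:R `^ alpha :> R.
  by rewrite /powR gt_eqF // -{2}[d%:R]lnK ?posrE // -expRD; congr expR; ring.
by [].
Qed.
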